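(* Let $(\sigma_i^2,s_i^2)$, $i=1,\dots,N$, follow the hierarchical model in which $\sigma_i^2\overset{iid}{\sim} g$ (an arbitrary prior on $(0,\infty)$) and, conditionally on the variances, the $s_i^2$ are independent with $s_i^2\mid\sigma_i^2\sim \sigma_i^2\chi_k^2/k$. Let $F$ be the marginal cumulative distribution function of $s_i^2$. Consider the loss function $$L_1\left(\sigma^2_{[1:N]},\hat\sigma^2_{[1:N]}\right)=\sum_{i=1}^N\left(\frac{\sigma_i^2}{\hat\sigma_i^2}-1\right)^2 .$$ If $$\int_0^\infty (s^2)^{-(\frac k2-2)}\,dF(s^2)<\infty\quad\text{and}\quad \int_0^\infty (s^2)^{-(\frac k2-1)}\,dF(s^2)<\infty,$$ then the Bayes rule $(\hat\sigma_{1,B}^{2},\dots,\hat\sigma_{N,B}^{2})$ under $L_1$ is given by $$\hat\sigma_{i,B}^{2}=\frac k2\left\{\frac{\int_{s_i^2}^\infty (s^2)^{-(\frac k2-2)}\,dF(s^2)}{\int_{s_i^2}^\infty (s^2)^{-(\frac k2-1)}\,dF(s^2)}-s_i^2\right\},\qquad i=1,\dots,N.$$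
   Context: $k$ is the (known) degrees of freedom, $\chi_k^2$ denotes a chi-square random variable with $k$ degrees of freedom, and $p(s^2\mid\sigma^2)$ denotes the density of $s^2$ given $\sigma^2$, i.e. of $\sigma^2\chi^2_k/k$. $g$ denotes the prior density of $\sigma_i^2$. The marginal density of the sample variances is $f(s^2)=\int_0^\infty p(s^2\mid\sigma^2)g(\sigma^2)\,d\sigma^2$ for $s^2>0$, and $F(x)=\int_0^x f(s^2)\,ds^2$ is the corresponding marginal cumulative distribution function. In integrals, $s^2$ is treated as a single positive integration variable. Notation: $\sigma^2_{[1:N]}=(\sigma_1^2,\dots,\sigma_N^2)$, $\hat\sigma^2_{[1:N]}=(\hat\sigma_1^2,\dots,\hat\sigma_N^2)$, $s^2_{[1:N]}=(s_1^2,\dots,s_N^2)$. The Bayes rule for a loss $L$ is the function of the data $s^2_{[1:N]}$ minimizing the posterior expected loss $E[L(\sigma^2_{[1:N]},\hat\sigma^2_{[1:N]})\mid s^2_{[1:N]}]$ over positive $\hat\sigma_1^2,\dots,\hat\sigma_N^2$. *)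

(* Defs.v *)
From HB Require Import structures.
From mathcomp Require Import all_boot all_order all_algebra.
From mathcomp Require Import all_classical all_reals all_analysis.

Set Implicit Arguments.
Unset Strict Implicit.
Unset Printing Implicit Defensive.
Import Order.TTheory GRing.Theory Num.Theory.
Import numFieldNormedType.Exports.

Local Open Scope classical_set_scope.
Local Open Scope ring_scope.

(* Variances and sample variances are themselves the
   variables here: [v] stands for sigma^2 and [t] for s^2. *)

Notation leb := lebesgue_measure.
(* R^N with its product sigma-algebra *)
Notation vec R N := (N.-tuple (measurableTypeR R)).

Definition gamma_function {R : realType} (a : R) : R :=
  \int[leb]_(t in `]0, +oo[) (t `^ (a - 1) * expR (- t)).

(* Densities are written on (0, +oo) only, and are always integrated there. *)
Definition chi_square_pdf {R : realType} (k : nat) (x : R) : R :=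
  x `^ (k%:R / 2 - 1) * expR (- x / 2)
  / (2 `^ (k%:R / 2) * gamma_function (k%:R / 2)).

(* p(t | v): the density at t of v * chi^2_k / k (change of scale) *)
Definition sample_var_pdf {R : realType} (k : nat) (v t : R) : R :=
  k%:R / v * chi_square_pdf k (k%:R * t / v).

Definition sample_var_law {R : realType} (k : nat) (v : R)
    (B : set (measurableTypeR R)) : \bar R :=
  (\int[leb]_(t in B `&` `]0%R, +oo[) (sample_var_pdf k v t)%:E)%E.

Record prior_density {R : realType} (g : R -> R) : Prop := {
  prior_measurable :
    @measurable_fun _ _ (measurableTypeR R) (measurableTypeR R) `]0, +oo[ g ;
  prior_ge0 : forall v, 0 < v -> 0 <= g v ;
  prior_total : (\int[leb]_(v in `]0%R, +oo[) (g v)%:E = 1)%E }.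

Definition marginal_pdf {R : realType} (k : nat) (g : R -> R) (t : R) : \bar R :=
  (\int[leb]_(v in `]0%R, +oo[) (sample_var_pdf k v t * g v)%:E)%E.

Definition marginal_cdf {R : realType} (k : nat) (g F : R -> R) : Prop :=
  forall x, ((F x)%:E = \int[leb]_(t in `]0%R, x]) marginal_pdf k g t)%E.

(* Product rule over the full family; taking some of the [A i] to be the whole
   line gives it for every subfamily. *)
Definition independent_components d (Omega : measurableType d) (R : realType)
    (P : probability Omega R) (N : nat) (X : {mfun Omega >-> vec R N}) : Prop :=
  forall A : 'I_N -> set (measurableTypeR R), (forall i, measurable (A i)) ->
  (P [set w | forall i, A i (tnth (X w) i)] =
   \prod_(i < N) P [set w | A i (tnth (X w) i)])%E.

Record hierarchical_model d (Omega : measurableType d) (R : realType)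
    (P : probability Omega R) (k N : nat) (g : R -> R)
    (sigma2 s2 : {mfun Omega >-> vec R N}) : Prop := {
  variances_indep : independent_components P sigma2 ;
  variances_law : forall i (A : set (measurableTypeR R)), measurable A ->
    (P [set w | A (tnth (sigma2 w) i)] =
     \int[leb]_(v in A `&` `]0%R, +oo[) (g v)%:E)%E ;
  (* given sigma2, the components of s2 are independent with laws
     [sample_var_law k (sigma2 i)] *)
  samples_cond_law : forall (A : set (vec R N))
      (B : 'I_N -> set (measurableTypeR R)),
    measurable A -> (forall i, measurable (B i)) ->
    (P (sigma2 @^-1` A `&` [set w | forall i, B i (tnth (s2 w) i)]) =
     \int[P]_(w in sigma2 @^-1` A)
       \prod_(i < N) sample_var_law k (tnth (sigma2 w) i) (B i))%E }.

(* Regular conditional distribution of Y given X. *)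
Definition conditional_distribution d d1 d2 (Omega : measurableType d)
    (T1 : measurableType d1) (T2 : measurableType d2) (R : realType)
    (P : probability Omega R) (Y : {mfun Omega >-> T2})
    (X : {mfun Omega >-> T1}) (post : R.-pker T1 ~> T2) : Prop :=
  forall (A : set T2) (B : set T1), measurable A -> measurable B ->
  (P (Y @^-1` A `&` X @^-1` B) = \int[P]_(w in X @^-1` B) post (X w) A)%E.

Definition positive_vec {R : realType} (N : nat) (a : vec R N) : Prop :=
  forall i, 0 < tnth a i.

Definition posterior_expected_loss {R : realType} (N : nat)
    (L : vec R N -> vec R N -> R) (post : R.-pker (vec R N) ~> (vec R N))
    (x a : vec R N) : \bar R :=
  (\int[post x]_v (L v a)%:E)%E.

(* A posterior is determined only up to null sets of data, hence the almost
   everywhere quantifier; the rule is the unique minimizer. *)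
Definition bayes_rule d (Omega : measurableType d) (R : realType)
    (P : probability Omega R) (N : nat) (sigma2 s2 : {mfun Omega >-> vec R N})
    (L : vec R N -> vec R N -> R) (delta : vec R N -> vec R N) : Prop :=
  forall post : R.-pker (vec R N) ~> (vec R N),
  conditional_distribution P sigma2 s2 post ->
  {ae P, forall w, positive_vec (delta (s2 w)) /\
    forall a, positive_vec a -> a <> delta (s2 w) ->
      (posterior_expected_loss L post (s2 w) (delta (s2 w)) <
       posterior_expected_loss L post (s2 w) a)%E}.

Definition loss1 {R : realType} (N : nat) (sigma2 hat_sigma2 : vec R N) : R :=
  \sum_(i < N) (tnth sigma2 i / tnth hat_sigma2 i - 1) ^+ 2.

Definition F_bayes_estimator {R : realType} (k N : nat) (F : cumulative R R)
    (x : vec R N) : vec R N :=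
  let dF := lebesgue_stieltjes_measure F in
  [tuple k%:R / 2 *
    ((\int[dF]_(t in `]tnth x i, +oo[) t `^ (- (k%:R / 2 - 2))) /
     (\int[dF]_(t in `]tnth x i, +oo[) t `^ (- (k%:R / 2 - 1)))
     - tnth x i) | i < N].

(* Main.v *)
Require Import Defs.
From HB Require Import structures.
From mathcomp Require Import all_boot all_order all_algebra.
From mathcomp Require Import all_classical all_reals all_analysis.
From mathcomp Require Import measurable_realfun ring.

Set Implicit Arguments.
Unset Strict Implicit.
Unset Printing Implicit Defensive.
Import Order.TTheory GRing.Theory Num.Theory.
Import numFieldNormedType.Exports.

Local Open Scope classical_set_scope.
Local Open Scope ring_scope.

(** The loss is a sum over the coordinates, so for given data [x] the posterior
    risk of [u] is the sum over [i] of
    [e2 / u_i ^+ 2 - 2 * (e1 / u_i) + 1], where [e1] and [e2] are the first two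
    posterior moments of the [i]-th variance.  When [e1] and [e2] are positive
    and finite this is uniquely minimal at [u_i = e2 / e1]
    ([quadratic_ratio_lt]), so everything reduces to computing the posterior
    moments and recognizing [e2 / e1] in terms of the marginal law [F].

    Posterior moments ([posterior_expectation]).  The posterior is an arbitrary
    regular conditional distribution of the vector of variances given the vector
    of samples.  Since the pairs (variance, sample) are independent, the
    conditional expectation of [h] at the [i]-th variance depends on the [i]-th
    sample [t] only, and is given by Bayes' formula
    [M_h t / M_1 t], where [M_h t] is the integral over [v > 0] of
    [h v * p(t | v) * g v] ([evidence]).  This is proved by comparing both sides
    integrated over an event of the data: for an indicator [h] and a rectangular
    event it is independence plus Tonelli's theorem, a pi-lambda argument extends
    it to all events of the data, and linearity and monotone limits extend it to
    all nonnegative [h].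

    Recognizing the ratio ([tail_moment]).  With [a = k / 2] the sampling density
    is [p(t | v) = w v * t `^ (a - 1) * expR (- (a / v * t))].  Multiplying by
    [t `^ (- (a - 1))] leaves a pure exponential in [t], whose tail integrals
    beyond [x] are explicit: integrating [1] and [t] against it gives
    [v / a] and [x * v / a + v ^+ 2 / a ^+ 2] times its value at [x].  Since the
    measure [dF] has density [M_1], exchanging the order of integration yields,
    up to the common factor [x `^ (- (a - 1))], that the two tail integrals of the
    estimator are [M_v x / a] and [x * M_v x / a + M_(v^2) x / a ^+ 2].  Hence the
    estimator equals [M_(v^2) x / M_v x = e2 / e1] ([tail_ratioE]); the two
    integrability assumptions on [F] make these moments finite.

    The moments are positive for almost all data because the posterior
    expectation of the constant [1] is [1], which forces [0 < M_1 < +oo] at almost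
    every sample.

    All the extensions from indicators to functions go through one notion, the
    functionals that behave like an integral on nonnegative measurable functions
    ([integral_like]): two of them that agree on indicators, or on the indicators
    of a generating pi-system when they are finite, are equal. *)

(** * Integral-like functionals *)

Section integral_like.
Local Open Scope ereal_scope.

Definition nonneg_mfun d (T : measurableType d) (R : realType)
    (f : T -> \bar R) : Prop :=
  measurable_fun [set: T] f /\ forall x, 0 <= f x.

(** Daniell's axioms for an integral, restricted to nonnegative measurable
    functions.  The formulas of this file (integrals of conditional integrals,
    weighted expectations of a function of a random variable) are linear and
    monotone in a test function without being literally integrals of it against
    a given measure; this record is what they have in common. *)
Record integral_like d (T : measurableType d) (R : realType)
    (Phi : (T -> \bar R) -> \bar R) : Prop := {
  il_ge0 : forall f, nonneg_mfun f -> 0 <= Phi f ;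
  il_le : forall f g, nonneg_mfun f -> nonneg_mfun g ->
    (forall x, f x <= g x) -> Phi f <= Phi g ;
  il_add : forall f g, nonneg_mfun f -> nonneg_mfun g ->
    Phi (fun x => f x + g x) = Phi f + Phi g ;
  il_scale : forall (c : R) f, (0 <= c)%R -> nonneg_mfun f ->
    Phi (fun x => c%:E * f x) = c%:E * Phi f ;
  il_mono : forall (h : nat -> T -> \bar R) f,
    (forall n, nonneg_mfun (h n)) -> nonneg_mfun f ->
    (forall x, nondecreasing_seq (h ^~ x)) ->
    (forall x, h n x @[n --> \oo] --> f x) ->
    Phi (h n) @[n --> \oo] --> Phi f }.

Definition indicator (T : Type) (R : realType) (A : set T) : T -> \bar R :=
  fun x => (\1_A x)%:E.

Context {R : realType}.

Lemma nonneg_mfun_indicator d (T : measurableType d) (A : set T) :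
  measurable A -> nonneg_mfun (indicator R A).
Proof.
move=> mA; split=> [|x]; first exact/measurable_EFinP/measurable_indic.
by rewrite lee_fin.
Qed.

Lemma nonneg_mfunM d (T : measurableType d) (f g : T -> \bar R) :
  nonneg_mfun f -> nonneg_mfun g -> nonneg_mfun (fun x => f x * g x).
Proof.
move=> [mf f0] [mg g0]; split=> [|x]; last exact: mule_ge0.
exact: emeasurable_funM.
Qed.

Lemma nonneg_mfun_cst d (T : measurableType d) (c : \bar R) :
  0 <= c -> nonneg_mfun (fun _ : T => c).
Proof. by move=> c0; split. Qed.

Lemma nonneg_mfun_comp d d' (T : measurableType d) (T' : measurableType d')
  (f : T -> \bar R) (X : T' -> T) : measurable_fun setT X ->
  nonneg_mfun f -> nonneg_mfun (fun x => f (X x)).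
Proof. by move=> mX [mf f0]; split => //; exact: measurableT_comp. Qed.

Lemma nonneg_mfun_sum d (T : measurableType d) (I : Type) (s : seq I)
  (f : I -> T -> \bar R) : (forall i, nonneg_mfun (f i)) ->
  nonneg_mfun (fun x => \sum_(i <- s) f i x).
Proof.
move=> hf; split=> [|x]; last by apply: sume_ge0 => i _; exact: (hf i).2.
by apply: emeasurable_sum => i; exact: (hf i).1.
Qed.

Lemma nonneg_mfun_prod d (T : measurableType d) (I : Type) (s : seq I)
  (p : pred I) (f : I -> T -> \bar R) : (forall i, nonneg_mfun (f i)) ->
  nonneg_mfun (fun x => \prod_(i <- s | p i) f i x).
Proof.
move=> hf; elim: s => [|i s ih].
  rewrite (_ : (fun _ => _) = fun _ => 1); first exact: nonneg_mfun_cst.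
  by apply/funext => x; rewrite big_nil.
case: (boolP (p i)) => pi.
  rewrite (_ : (fun _ => _) =
      fun x => f i x * \prod_(j <- s | p j) f j x); first exact: nonneg_mfunM.
  by apply/funext => x; rewrite big_cons pi.
rewrite (_ : (fun _ => _) = fun x => \prod_(j <- s | p j) f j x)//.
by apply/funext => x; rewrite big_cons (negbTE pi).
Qed.

(** Monotonicity makes multiplication by [+oo] harmless: the sequence is either
    identically zero or eventually positive. *)
Lemma cvge_nondecreasing_mull (c l : \bar R) (u : nat -> \bar R) :
  0 <= c -> (forall n, 0 <= u n) -> nondecreasing_seq u ->
  u n @[n --> \oo] --> l -> c * u n @[n --> \oo] --> c * l.
Proof.
move=> c0 u0 ndu ul; case: c c0 => [c c0|_|//].
  exact: cvgeZl.
have l_ub n : u n <= l.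
  rewrite (cvg_unique _ ul (ereal_nondecreasing_cvgn ndu))//.
  by apply: ereal_sup_ubound; exists n.
have l0 : 0 <= l := le_trans (u0 0%N) (l_ub 0%N).
have [l_eq0|l_neq0] := eqVneq l 0.
  rewrite l_eq0 mule0 (_ : (fun n => _) = cst 0); first exact: cvg_cst.
  apply/funext => n /=; suff -> : u n = 0 by rewrite mule0.
  by apply/eqP; rewrite eq_le u0 andbT -l_eq0.
have [N uN] : exists N, 0 < u N.
  apply: contrapT => /forallNP uneg; move/eqP: l_neq0; apply.
  rewrite -(cvg_lim _ ul)// (_ : u = cst 0) ?lim_cst//.
  apply/funext => n /=; apply/eqP; rewrite eq_le u0 andbT leNgt.
  exact/negP/uneg.
have lgt0 : 0 < l by rewrite lt_def l_neq0.
rewrite gt0_mulye//; apply: cvg_near_cst; exists N => // n /= Nn.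
by rewrite gt0_mulye//; exact: lt_le_trans uN (ndu _ _ Nn).
Qed.

Lemma integral_like_measure d (T : measurableType d)
  (mu : {measure set T -> \bar R}) :
  integral_like (fun f => \int[mu]_x f x).
Proof.
split => [f [mf f0]|f g [mf f0] [mg g0] fg|f g [mf f0] [mg g0]|c f c0 [mf f0]|].
- exact: integral_ge0.
- exact: ge0_le_integral.
- exact: ge0_integralD.
- exact: ge0_integralZl.
move=> h f hh [mf f0] ndh hf.
rewrite [X in _ --> X](_ : _ = \int[mu]_x (fun x => limn (h ^~ x)) x).
  by apply: cvg_monotone_convergence => // [n|n x _];
    [exact: (hh n).1|exact: (hh n).2].
by apply: eq_integral => x _; apply/esym/cvg_lim => //; exact: hf.
Qed.

Lemma integral_like_at d (T : measurableType d) (a : T) :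
  integral_like (fun f : T -> \bar R => f a).
Proof. by split => // f [_ f0]. Qed.

Lemma integral_like_scale d (T : measurableType d) (c : \bar R)
  (Phi : (T -> \bar R) -> \bar R) : 0 <= c ->
  integral_like Phi -> integral_like (fun f => c * Phi f).
Proof.
move=> c0 hPhi; split.
- by move=> f hf; rewrite mule_ge0// (il_ge0 hPhi).
- by move=> f g hf hg fg; rewrite lee_wpmul2l// (il_le hPhi).
- by move=> f g hf hg; rewrite (il_add hPhi)// ge0_muleDr// (il_ge0 hPhi).
- by move=> r f r0 hf; rewrite (il_scale hPhi)// muleCA.
- move=> h f hh hf ndh hhf; apply: cvge_nondecreasing_mull => //.
  + by move=> n; rewrite (il_ge0 hPhi).
  + by move=> m n mn; apply: (il_le hPhi) => // x; exact: ndh.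
  + exact: (il_mono hPhi).
Qed.

Lemma integral_like_comp d d' (T : measurableType d) (T' : measurableType d')
  (X : T' -> T) (Phi : (T' -> \bar R) -> \bar R) : measurable_fun setT X ->
  integral_like Phi ->
  integral_like (fun f : T -> \bar R => Phi (fun x => f (X x))).
Proof.
move=> mX hPhi; have hX := nonneg_mfun_comp mX; split.
- by move=> f /hX; exact: il_ge0.
- by move=> f g /hX hf /hX hg fg; exact: (il_le hPhi).
- by move=> f g /hX hf /hX hg; exact: (il_add hPhi).
- by move=> c f c0 /hX hf; exact: (il_scale hPhi).
- by move=> h f hh /hX hf ndh hhf; apply: (il_mono hPhi) => // n; exact: hX.
Qed.

(** The closure property that makes the notion useful: a mixture, over a
    parameter, of integral-like functionals is integral-like, by linearity and
    monotone convergence for the mixing measure. *)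
Lemma integral_like_mix d d' (T : measurableType d) (S : measurableType d')
  (mu : {measure set S -> \bar R}) (D : set S)
  (Psi : S -> (T -> \bar R) -> \bar R) :
  measurable D ->
  (forall x, D x -> integral_like (Psi x)) ->
  (forall f, nonneg_mfun f -> measurable_fun D (Psi ^~ f)) ->
  integral_like (fun f => \int[mu]_(x in D) Psi x f).
Proof.
move=> mD hPsi mPsi; split.
- by move=> f hf; apply: integral_ge0 => x /hPsi /il_ge0; exact.
- move=> f g hf hg fg; apply: ge0_le_integral => //; try exact: mPsi.
  + by move=> x /hPsi /il_ge0; exact.
  + by move=> x /hPsi /il_le; exact.
- move=> f g hf hg; rewrite -ge0_integralD//; try exact: mPsi.
  + by apply: eq_integral => x /[!inE] /hPsi /il_add; exact.
  + by move=> x /hPsi /il_ge0; exact.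
  + by move=> x /hPsi /il_ge0; exact.
- move=> c f c0 hf; rewrite -ge0_integralZl//; try exact: mPsi.
  + by apply: eq_integral => x /[!inE] /hPsi /il_scale; exact.
  + by move=> x /hPsi /il_ge0; exact.
- move=> h f hh hf ndh hhf.
  rewrite [X in _ --> X](_ : _ =
      \int[mu]_(x in D) (fun x => limn (fun n => Psi x (h n))) x).
    apply: cvg_monotone_convergence => // [n|n x|x].
    + exact: mPsi.
    + by move=> /hPsi /il_ge0; exact.
    + by move=> /hPsi hx m n mn; apply: (il_le hx) => // y; exact: ndh.
  apply: eq_integral => x /[!inE] /hPsi hx; apply/esym/cvg_lim => //.
  exact: (il_mono hx).
Qed.

Lemma integral_like_sum d (T : measurableType d)
  (Phi : (T -> \bar R) -> \bar R) (I : Type) (s : seq I)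
  (f : I -> T -> \bar R) : integral_like Phi ->
  (forall i, nonneg_mfun (f i)) ->
  Phi (fun x => \sum_(i <- s) f i x) = \sum_(i <- s) Phi (f i).
Proof.
move=> hPhi hf; elim: s => [|i s ih].
  rewrite big_nil (_ : (fun _ => _) = fun x => 0%:E * (fun=> 0) x).
    by rewrite (il_scale hPhi)// ?mul0e//; exact: nonneg_mfun_cst.
  by apply/funext => x; rewrite big_nil mul0e.
rewrite big_cons -ih -(il_add hPhi)//; last exact: nonneg_mfun_sum.
by congr Phi; apply/funext => x; rewrite big_cons.
Qed.

Import HBNNSimple.

(** Nonnegative measurable functions are increasing limits of nonnegative simple
    functions, which are combinations of indicators. *)
Lemma integral_like_eq d (T : measurableType d)
  (Phi Psi : (T -> \bar R) -> \bar R) :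
  integral_like Phi -> integral_like Psi ->
  (forall A, measurable A -> Phi (indicator R A) = Psi (indicator R A)) ->
  forall f, nonneg_mfun f -> Phi f = Psi f.
Proof.
move=> hPhi hPsi eqA.
have on_simple (h : {nnsfun T >-> R}) : Phi (fun x => (h x)%:E) = Psi (fun x => (h x)%:E).
  have -> : (fun x => (h x)%:E) = fun x => \sum_(y <- finmap.enum_fset (fset_set (range h)))
      (* the maximum makes each coefficient nonnegative, also off the range *)
      (Num.max y 0)%R%:E * indicator R (h @^-1` [set y]) x.
    apply/funext => x /=; rewrite fimfunE fsbig_finite//= -sumEFin.
    rewrite big_seq [in RHS]big_seq; apply: eq_bigr => y.
    rewrite in_fset_set// inE => -[z _ <-]; rewrite -EFinM.
    by congr ((_ * _)%:E); rewrite max_l.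
  have mh y : measurable (h @^-1` [set y]) by exact: measurable_sfunP.
  have hi y : nonneg_mfun (indicator R (h @^-1` [set y])).
    exact: nonneg_mfun_indicator.
  have m0 y : (0 <= Num.max y 0 :> R)%R by rewrite le_max lexx orbT.
  rewrite !integral_like_sum//; first apply: eq_bigr => y _.
  - by rewrite (il_scale hPhi)// (il_scale hPsi)// eqA.
  - by move=> y; apply: nonneg_mfunM => //; apply: nonneg_mfun_cst; rewrite lee_fin.
  - by move=> y; apply: nonneg_mfunM => //; apply: nonneg_mfun_cst; rewrite lee_fin.
move=> f [mf f0]; pose h := nnsfun_approx measurableT mf.
have hh n : nonneg_mfun (fun x => (h n x)%:E).
  by split=> [|x] /=; [exact/measurable_EFinP|rewrite lee_fin].
have ndh x : nondecreasing_seq (fun n => (h n x)%:E).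
  by move=> m n mn; rewrite lee_fin; exact/lefP/nd_nnsfun_approx.
have hf x : (h n x)%:E @[n --> \oo] --> f x.
  exact: cvg_nnsfun_approx.
have /cvg_lim <- // := il_mono hPhi hh (conj mf f0) ndh hf.
have /cvg_lim <- // := il_mono hPsi hh (conj mf f0) ndh hf.
by congr (lim (_ @ \oo)); apply/funext => n; exact: on_simple.
Qed.

(** Bridge to measures, so that the uniqueness of measures that agree on a
    generating pi-system applies to integral-like functionals. *)
Lemma integral_like_measureE d (T : measurableType d)
  (Phi : (T -> \bar R) -> \bar R) : integral_like Phi ->
  exists nu : {measure set T -> \bar R},
    forall A, measurable A -> nu A = Phi (indicator R A).
Proof.
move=> hPhi.
(* a measure must be nonnegative on all sets, hence the default value 0 *)
pose nu (A : set T) := if pselect (measurable A) then Phi (indicator R A) else 0.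
have nuE A : measurable A -> nu A = Phi (indicator R A).
  by rewrite /nu; case: pselect.
have nu0 : nu set0 = 0.
  rewrite nuE// (_ : indicator R set0 = fun x => 0%:E * (fun=> 0) x).
    by rewrite (il_scale hPhi)// ?mul0e//; exact: nonneg_mfun_cst.
  by apply/funext => x; rewrite mul0e /indicator indicE in_set0.
have nu_ge0 A : 0 <= nu A.
  rewrite /nu; case: pselect => // mA; apply: (il_ge0 hPhi).
  exact: nonneg_mfun_indicator.
have nu_sigma : semi_sigma_additive nu.
  move=> F mF tF mUF.
  pose h n x := \sum_(0 <= i < n) indicator R (F i) x.
  have hI i : nonneg_mfun (indicator R (F i)) by exact: nonneg_mfun_indicator.
  rewrite nuE// (_ : (fun n => _) = fun n => Phi (h n)); last first.
    apply/funext => n; rewrite integral_like_sum//.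
    by apply: eq_bigr => i _; rewrite nuE.
  apply: (il_mono hPhi).
  - by move=> n; exact: nonneg_mfun_sum.
  - exact: nonneg_mfun_indicator.
  - by move=> x; apply: ereal_nondecreasing_series => i _ _; exact: (hI i).2.
  - move=> x; rewrite /h /indicator.
    exact: (@measure_semi_sigma_additive _ _ _
      (\d_x : {measure set T -> \bar R}) F mF tF mUF).
pose B := isMeasure.Build d T R nu nu0 nu_ge0 nu_sigma.
pose m : {measure set T -> \bar R} := HB.pack nu B.
by exists m.
Qed.

Lemma integral_like_unique d (T : measurableType d) (G : set (set T))
  (Phi Psi : (T -> \bar R) -> \bar R) :
  measurable = <<s G >> -> setI_closed G -> G setT ->
  integral_like Phi -> integral_like Psi ->
  (forall A, G A -> Phi (indicator R A) = Psi (indicator R A)) ->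
  Phi (fun=> 1) < +oo ->
  forall f, nonneg_mfun f -> Phi f = Psi f.
Proof.
move=> mG GI GT hPhi hPsi eqG Phi1.
apply: integral_like_eq => // A mA.
have [m1 m1E] := integral_like_measureE hPhi.
have [m2 m2E] := integral_like_measureE hPsi.
have Gm B : G B -> measurable B by move=> GB; rewrite mG; exact: sub_gen_smallest.
rewrite -m1E// -m2E//; apply: (measure_unique G (fun=> setT)) => //.
- by rewrite bigcup_const//; exists 0%N.
- by move=> B GB; rewrite m1E ?m2E//; [exact: eqG|exact: Gm|exact: Gm].
- move=> _; rewrite m1E// (_ : indicator R setT = fun=> 1)//.
  by apply/funext => x; rewrite /indicator indicT.
Qed.

End integral_like.

(** * Rectangles, independence and almost everywhere equality *)

Section probability_tools.
Local Open Scope ereal_scope.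
Context {R : realType}.

Lemma integral_like_weighted d d' (S : measurableType d) (T : measurableType d')
  (mu : {measure set S -> \bar R}) (G : S -> \bar R) (X : S -> T) :
  nonneg_mfun G -> measurable_fun setT X ->
  integral_like (fun f : T -> \bar R => \int[mu]_w (G w * f (X w))).
Proof.
move=> [mG G0] mX; apply: integral_like_mix => //.
- move=> w _; apply: integral_like_scale => //.
  exact: (integral_like_at (X w)).
- move=> f [mf f0]; apply: emeasurable_funM => //; exact: measurableT_comp.
Qed.

Lemma integral_indicator d (T : measurableType d)
  (mu : {measure set T -> \bar R}) (A : set T) : measurable A ->
  \int[mu]_x indicator R A x = mu A.
Proof. by move=> mA; rewrite integral_indic// setIT. Qed.

Definition rectangle (T : Type) N (B : 'I_N -> set T) : set (N.-tuple T) :=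
  [set x | forall i, B i (tnth x i)].

Definition rectangles d (T : measurableType d) N : set (set (N.-tuple T)) :=
  [set rectangle B | B in [set B | forall i, measurable (B i)]].

Lemma measurable_rectangle d (T : measurableType d) N (B : 'I_N -> set T) :
  (forall i, measurable (B i)) -> measurable (rectangle B).
Proof.
move=> mB; rewrite (_ : rectangle B =
    \bigcap_(i in [set: 'I_N]) ((fun x => tnth x i) @^-1` B i)); last first.
  by apply/seteqP; split=> [x xB i _|x xB i]; [exact: xB|exact: xB].
apply: fin_bigcap_measurable => // i _; rewrite -[X in measurable X]setTI.
exact: measurable_tnth.
Qed.

Lemma setI_closed_rectangles d (T : measurableType d) N :
  setI_closed (@rectangles d T N).
Proof.
move=> _ _ [A mA <-] [B mB <-]; exists (fun i => A i `&` B i).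
  by move=> i; apply: measurableI; [exact: mA|exact: mB].
apply/seteqP; split=> [x xAB|x [xA xB] i]; last by split.
by split=> i; have [] := xAB i.
Qed.

Lemma rectangles_setT d (T : measurableType d) N : @rectangles d T N setT.
Proof.
by exists (fun=> setT) => //; apply/seteqP; split.
Qed.

Lemma measurable_rectangles d (T : measurableType d) N :
  (measurable : set (set (N.-tuple T))) = <<s @rectangles d T N >>.
Proof.
apply/seteqP; split; last first.
  apply: smallest_sub; first exact: sigma_algebra_measurable.
  by move=> _ [B mB <-]; exact: measurable_rectangle.
rewrite {1}/measurable/= /g_sigma_preimage; apply: sub_smallest2r.
  exact: smallest_sigma_algebra.
apply: (big_ind (fun S => S `<=` _)); [exact: sub0set|by move=> A B ? ?; rewrite subUset|].
move=> i _ C [A mA <-].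
exists (fun j => if j == i then A else setT).
  by move=> j /=; case: ifP.
apply/seteqP; split=> [x /(_ i)|x [_ xA] j] /=; first by rewrite eqxx.
by case: ifP => [/eqP ->|].
Qed.

(** The function [f] need not be integrable: on each set where [g <= n] the
    function [g] is, and these sets exhaust the space. *)
Lemma ae_eq_of_integrals d (T : measurableType d)
  (mu : {finite_measure set T -> \bar R}) (f g : T -> \bar R) :
  nonneg_mfun f -> nonneg_mfun g -> (forall x, g x < +oo) ->
  (forall E, measurable E -> \int[mu]_(x in E) f x = \int[mu]_(x in E) g x) ->
  {ae mu, forall x, f x = g x}.
Proof.
move=> [mf f0] [mg g0] g_fin fg.
pose D n := [set x | g x <= n%:R%:E].
have mD n : measurable (D n).
  rewrite -[X in measurable X]setTI.
  exact: emeasurable_fun_infty_c.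
have aeD n : {ae mu, forall x, D n x -> f x = g x}.
  suff : ae_eq mu (D n) g f by apply: filterS => x /[apply] ->.
  apply: integral_ae_eq => //.
  - apply: (le_integrable (mD n) (g := EFin \o cst n%:R)).
    + exact: measurable_funTS.
    + by move=> x Dx /=; rewrite gee0_abs// ger0_norm.
    + exact: finite_measure_integrable_cst.
  - exact: measurable_funTS.
  - by move=> E _ mE; rewrite fg.
have := ae_foralln aeD; apply: filterS => x fgx.
apply: (fgx (Num.truncn (fine (g x))).+1).
rewrite /D/= -[leLHS]fineK ?ge0_fin_numE// lee_fin ltW//.
by apply: truncnS_gt.
Qed.

Lemma prod_indicator (T : Type) N (A : 'I_N -> set T) (x : N.-tuple T) :
  \prod_(i < N) indicator R (A i) (tnth x i) = indicator R (rectangle A) x.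
Proof.
rewrite /indicator; have [xA|xA] := pselect (rectangle A x).
  rewrite big1 ?indicE ?mem_set// => i _.
  by rewrite indicE mem_set.
have [i xAi] : exists i, ~ A i (tnth x i) by exact/existsNP.
rewrite (bigD1 i)//= !indicE memNset// memNset ?mul0e//.
Qed.

Definition independent_family d d' (Omega : measurableType d)
    (T : measurableType d') (P : probability Omega R) N
    (X : Omega -> N.-tuple T) : Prop :=
  forall A : 'I_N -> set T, (forall i, measurable (A i)) ->
  P (X @^-1` rectangle A) = \prod_(i < N) P [set w | A i (tnth (X w) i)].

(** For indicators this is the definition of independence.  Indicators are
    replaced by general functions one coordinate at a time: when all the other
    factors are fixed, both sides are integral-like in the remaining one. *)
Lemma independent_expectation_prod d d' (Omega : measurableType d)
  (T : measurableType d') (P : probability Omega R) N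
  (X : Omega -> N.-tuple T) (f : 'I_N -> T -> \bar R) :
  measurable_fun setT X -> independent_family P X ->
  (forall i, nonneg_mfun (f i)) ->
  \int[P]_w (\prod_(i < N) f i (tnth (X w) i)) =
  \prod_(i < N) \int[P]_w f i (tnth (X w) i).
Proof.
move=> mX indX hf.
have mXi i : measurable_fun setT (fun w => tnth (X w) i).
  exact: (measurableT_comp (measurable_tnth i) mX).
(* the first [n] factors are arbitrary, the others are indicators *)
suff main n : (n <= N)%N -> forall h : 'I_N -> T -> \bar R,
    (forall i, nonneg_mfun (h i)) ->
    (forall i : 'I_N, (n <= i)%N ->
       exists2 A, measurable A & h i = indicator R A) ->
    \int[P]_w (\prod_(i < N) h i (tnth (X w) i)) =
    \prod_(i < N) \int[P]_w h i (tnth (X w) i).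
  apply: (main N (leqnn N)) => // i; have := ltn_ord i.
  by rewrite ltnNge => /negP.
elim: n => [_|n ih nN] h hh hA.
  have [A mA] : exists2 A : 'I_N -> set T, (forall i, measurable (A i)) &
      h = fun i => indicator R (A i).
    have /choice[A hAE] : forall i, exists A, measurable A /\ h i = indicator R A.
      by move=> i; have [A mA ->] := hA i (leq0n _); exists A.
    by exists A => [i|]; [exact: (hAE i).1|apply/funext => i; exact: (hAE i).2].
  move=> ->.
  transitivity (\int[P]_w indicator R (X @^-1` rectangle A) w).
    by apply: eq_integral => w _; rewrite prod_indicator.
  rewrite integral_indicator; last first.
    rewrite -[X in measurable X]setTI.
    by apply: mX => //; exact: measurable_rectangle.
  rewrite [LHS](indX _ mA); apply: eq_bigr => i _.
  apply/esym/integral_indicator.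
  by rewrite -[X in measurable X]setTI; exact: mXi.
pose i0 := Ordinal nN.
pose G w := \prod_(i < N | i != i0) h i (tnth (X w) i).
pose c := \prod_(i < N | i != i0) \int[P]_w h i (tnth (X w) i).
have hG : nonneg_mfun G.
  apply: nonneg_mfun_prod => i.
  by have := nonneg_mfun_comp (mXi i) (hh i).
have c0 : 0 <= c.
  by apply: prode_ge0 => i _; apply: integral_ge0 => w _; exact: (hh i).2.
suff E : forall q, nonneg_mfun q ->
    \int[P]_w (G w * q (tnth (X w) i0)) = c * \int[P]_w (1 * q (tnth (X w) i0)).
  rewrite (bigD1 i0)//= muleC -/c.
  under eq_integral do rewrite (bigD1 i0)//= muleC -/(G _).
  by rewrite E//; under eq_integral do rewrite mul1e.
apply: integral_like_eq.
- exact: integral_like_weighted.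
- apply: integral_like_scale => //.
  by apply: (integral_like_weighted P (G := fun=> 1)) => //; exact: nonneg_mfun_cst.
move=> A mA.
pose h' i := if i == i0 then indicator R A else h i.
have h'E i : i != i0 -> h' i = h i by rewrite /h' => /negbTE ->.
have h'0 : h' i0 = indicator R A by rewrite /h' eqxx.
have hh' i : nonneg_mfun (h' i).
  by rewrite /h'; case: ifP => // _; exact: nonneg_mfun_indicator.
have hA' (i : 'I_N) : (n <= i)%N ->
    exists2 A, measurable A & h' i = indicator R A.
  move=> ni; rewrite /h'; case: eqP => [_|/eqP ii0]; first by exists A.
  apply: hA; rewrite ltn_neqAle ni andbT.
  by apply: contra ii0 => /eqP ni0; apply/eqP/val_inj.
transitivity (\int[P]_w \prod_(i < N) h' i (tnth (X w) i)).
  apply: eq_integral => w _; rewrite [in RHS](bigD1 i0)//= h'0 muleC.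
  by congr (_ * _); apply: eq_bigr => i /h'E ->.
rewrite (ih (ltnW nN) h' hh' hA') (bigD1 i0)//= h'0 muleC.
congr (_ * _); first by apply: eq_bigr => i /h'E ->.
by apply: eq_integral => w _; rewrite mul1e.
Qed.

End probability_tools.

(** * Bayes' formula *)

Section bayes_formula.
Local Open Scope ereal_scope.
Context {R : realType} d1 d2 (V : measurableType d1) (T : measurableType d2)
  (mV : {sigma_finite_measure set V -> \bar R})
  (mT : {sigma_finite_measure set T -> \bar R})
  (p : V * T -> \bar R) (g : V -> \bar R).
Hypotheses (hp : nonneg_mfun p) (hg : nonneg_mfun g).

(** Unnormalized posterior expectation of [h] given the observation [t], for the
    prior density [g] and the sampling density [p]; at [h = 1] it is the marginal
    density of the observation. *)
Definition evidence (h : V -> \bar R) (t : T) : \bar R :=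
  \int[mV]_v (h v * g v * p (v, t)).

(** Where the marginal density is [0] or [+oo] the factor is [0], so that this
    function is defined, nonnegative and measurable everywhere; such
    observations have probability zero. *)
Definition posterior_mean (h : V -> \bar R) (t : T) : \bar R :=
  evidence h t * ((fine (evidence (fun=> 1%E) t))^-1)%:E.

Let hpt t : nonneg_mfun (fun v => p (v, t)).
Proof. by apply: nonneg_mfun_comp => //; exact: measurable_fun_pair. Qed.

Let hpv v : nonneg_mfun (fun t => p (v, t)).
Proof. by apply: nonneg_mfun_comp => //; exact: measurable_fun_pair. Qed.

Let hjoint h : nonneg_mfun h ->
  nonneg_mfun (fun z : V * T => h z.1 * g z.1 * p z).
Proof.
move=> hh; apply: nonneg_mfunM => //; apply: nonneg_mfunM.
  by apply: (nonneg_mfun_comp _ hh).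
by apply: (nonneg_mfun_comp _ hg).
Qed.

Lemma nonneg_mfun_evidence h : nonneg_mfun h -> nonneg_mfun (evidence h).
Proof.
move=> /hjoint [mf f0]; split=> [|t].
  exact: (measurable_fun_fubini_tonelli_G _ mf f0).
by apply: integral_ge0 => v _; exact: (f0 (v, t)).
Qed.

Lemma evidence_le h h' t : nonneg_mfun h -> nonneg_mfun h' ->
  (forall v, h v <= h' v) -> evidence h t <= evidence h' t.
Proof.
move=> hh hh' hle.
have m q : nonneg_mfun q -> nonneg_mfun (fun v => q v * g v * p (v, t)).
  by move=> hq; apply: nonneg_mfunM => //; exact: nonneg_mfunM.
apply: ge0_le_integral => //.
- by move=> v _; exact: (m _ hh).2.
- exact: (m _ hh).1.
- exact: (m _ hh').1.
- by move=> v _; rewrite lee_wpmul2r ?lee_wpmul2r//; [exact: (hpt t).2|exact: hg.2].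
Qed.

Lemma nonneg_mfun_posterior_mean h : nonneg_mfun h ->
  nonneg_mfun (posterior_mean h).
Proof.
move=> hh; apply: nonneg_mfunM; first exact: nonneg_mfun_evidence.
have [m1 e1] := nonneg_mfun_evidence (nonneg_mfun_cst V (@lee01 R)).
split=> [|t]; last by rewrite lee_fin invr_ge0 fine_ge0.
apply/measurable_EFinP.
(* the power function is measurable on the whole line *)
rewrite (_ : (fun t => _) = fun t => (fine (evidence (fun=> 1%E) t) `^ (-1))%R).
  exact: measurableT_comp (measurable_powR _) (measurableT_comp _ m1).
by apply/funext => t; rewrite powR_inv1// fine_ge0.
Qed.

Lemma evidence_tonelli h (q : T -> \bar R) : nonneg_mfun h -> nonneg_mfun q ->
  \int[mT]_t (q t * evidence h t) =
  \int[mV]_v (h v * (\int[mT]_t (q t * p (v, t))) * g v).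
Proof.
move=> hh hq.
have hf : nonneg_mfun (fun z : V * T => q z.2 * (h z.1 * g z.1 * p z)).
  apply: nonneg_mfunM; last exact: hjoint.
  exact: (nonneg_mfun_comp _ hq).
have m t : nonneg_mfun (fun v => h v * g v * p (v, t)).
  by apply: nonneg_mfunM => //; exact: nonneg_mfunM.
transitivity (\int[mT]_t \int[mV]_v (q t * (h v * g v * p (v, t)))).
  apply: eq_integral => t _; rewrite ge0_integralZl//.
  - exact: (m t).1.
  - by move=> v _; exact: (m t).2.
  - exact: hq.2.
rewrite -(fubini_tonelli _ hf.1 hf.2)/=; apply: eq_integral => v _.
rewrite muleAC -ge0_integralZl//.
- by apply: eq_integral => t _; rewrite muleCA.
- by have [] := nonneg_mfunM hq (hpv v).
- by move=> t _; have [_] := nonneg_mfunM hq (hpv v); apply.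
- by rewrite mule_ge0//; [exact: hh.2|exact: hg.2].
Qed.

Context d (Omega : measurableType d) (P : probability Omega R) (N : nat)
  (theta : {mfun Omega >-> N.-tuple V}) (x : {mfun Omega >-> N.-tuple T}).

Hypothesis theta_indep : independent_family P theta.
Hypothesis theta_law : forall i (A : set V), measurable A ->
  P [set w | A (tnth (theta w) i)] = \int[mV]_v (indicator R A v * g v).
Hypothesis x_law : forall (A : set (N.-tuple V)) (B : 'I_N -> set T),
  measurable A -> (forall i, measurable (B i)) ->
  P (theta @^-1` A `&` x @^-1` rectangle B) =
  \int[P]_(w in theta @^-1` A)
    \prod_(i < N) \int[mT]_t (indicator R (B i) t * p (tnth (theta w) i, t)).

Let likelihood (B : set T) v := \int[mT]_t (indicator R B t * p (v, t)).

Let hlikelihood B : measurable B -> nonneg_mfun (likelihood B).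
Proof.
move=> mB.
have [mf f0] : nonneg_mfun (fun z : V * T => indicator R B z.2 * p z).
  apply: nonneg_mfunM => //.
  by apply: (nonneg_mfun_comp _ (nonneg_mfun_indicator mB)).
split=> [|v]; first exact: (measurable_fun_fubini_tonelli_F _ mf f0).
by apply: integral_ge0 => t _; exact: (f0 (v, t)).
Qed.

Let mtheta i : measurable_fun setT (fun w => tnth (theta w) i).
Proof. exact: (measurableT_comp (measurable_tnth i)). Qed.

Let measurable_theta_pre i (A : set V) : measurable A ->
  measurable [set w | A (tnth (theta w) i)].
Proof. by move=> mA; rewrite -[X in measurable X]setTI; exact: mtheta. Qed.

Let measurable_x_pre (B : set (N.-tuple T)) : measurable B ->
  measurable (x @^-1` B).
Proof.
by move=> mB; rewrite -[X in measurable X]setTI; exact: (measurable_funP x).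
Qed.

Let mx i : measurable_fun setT (fun w => tnth (x w) i).
Proof. exact: (measurableT_comp (measurable_tnth i)). Qed.

Lemma theta_expectation i (q : V -> \bar R) : nonneg_mfun q ->
  \int[P]_w q (tnth (theta w) i) = \int[mV]_v (q v * g v).
Proof.
move=> hq.
have E := integral_like_eq (R := R) (Phi := fun q => \int[P]_w q (tnth (theta w) i))
  (Psi := fun q => \int[mV]_v (g v * q v)).
rewrite E//; first by apply: eq_integral => v _; rewrite muleC.
- apply: (integral_like_comp (mtheta i)); exact: integral_like_measure.
- exact: (integral_like_weighted mV (X := id)).
move=> A mA; under [RHS]eq_integral do rewrite muleC.
rewrite -(theta_law i)//.
apply: (integral_indicator P (A := [set w | A (tnth (theta w) i)])).
exact: measurable_theta_pre.
Qed.

(** Contribution to the probability of a rectangle of the coordinates other than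
    [i]; by independence it splits off as a constant factor. *)
Let others (i : 'I_N) (B : 'I_N -> set T) : \bar R :=
  \prod_(j < N | j != i) \int[P]_w likelihood (B j) (tnth (theta w) j).

(** Conditioning on the parameters turns the probability into an expectation of a
    product of functions of the independent parameters; the factor of index [i]
    is then rewritten by Tonelli's theorem. *)
Lemma joint_law_rectangle i (A : set V) (B : 'I_N -> set T) :
  measurable A -> (forall j, measurable (B j)) ->
  P ([set w | A (tnth (theta w) i)] `&` x @^-1` rectangle B) =
  others i B *
    \int[mT]_t (indicator R (B i) t * evidence (indicator R A) t).
Proof.
move=> mA mB; have hA := nonneg_mfun_indicator (R := R) mA.
have mA' : measurable ((fun v : N.-tuple V => tnth v i) @^-1` A).
  by rewrite -[X in measurable X]setTI; exact: measurable_tnth.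
rewrite (x_law mA' mB).
pose f j := if j == i then fun v => indicator R A v * likelihood (B i) v
  else likelihood (B j).
have fE j : j != i -> f j = likelihood (B j) by rewrite /f => /negbTE ->.
have fi : f i = fun v => indicator R A v * likelihood (B i) v.
  by rewrite /f eqxx.
have hf j : nonneg_mfun (f j).
  rewrite /f; case: ifP => _; last exact: hlikelihood.
  by apply: nonneg_mfunM => //; exact: hlikelihood.
transitivity (\int[P]_w \prod_(j < N) f j (tnth (theta w) j)).
  rewrite integral_mkcond; apply: eq_integral => w _.
  rewrite (bigD1 i)//= fi (eq_bigr (fun j => likelihood (B j) (tnth (theta w) j))).
    rewrite -muleA patchE /indicator; case: ifPn.
      by rewrite inE/= => Aw; rewrite indicE mem_set// mul1e (bigD1 i).
    by rewrite notin_setE/= => Aw; rewrite indicE memNset// mul0e.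
  by move=> j /fE ->.
rewrite independent_expectation_prod// (bigD1 i)//= muleC fi; congr (_ * _).
  by apply: eq_bigr => j /fE ->.
rewrite (theta_expectation i (q := fun v => indicator R A v * likelihood (B i) v)).
  by rewrite evidence_tonelli//; exact: nonneg_mfun_indicator.
by apply: nonneg_mfunM => //; exact: hlikelihood.
Qed.

Let hevidence1 : nonneg_mfun (evidence (fun=> 1)).
Proof. exact/nonneg_mfun_evidence/nonneg_mfun_cst. Qed.

Let indicator_setT : indicator R [set: V] = fun=> 1.
Proof. by apply/funext => v; rewrite /indicator indicT. Qed.

(** Up to a constant factor, the integral of the marginal density is the total
    probability. *)
Lemma evidence_ae_finite (i : 'I_N) :
  {ae mT, forall t, evidence (fun=> 1) t < +oo}.
Proof.
have [me e0] := hevidence1.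
have : mT.-integrable setT (evidence (fun=> 1)).
  apply/integrableP; split => //.
  under eq_integral do rewrite gee0_abs//.
  have := @joint_law_rectangle i setT (fun=> setT) measurableT (fun=> measurableT).
  rewrite (_ : _ `&` _ = setT); last by apply/seteqP; split.
  rewrite probability_setT indicator_setT.
  under [in X in _ = X -> _]eq_integral do rewrite /indicator indicT mul1e.
  move=> total; rewrite ltey; apply/eqP => einf; move: total; rewrite einf.
  have : 0 <= others i (fun=> setT).
    by apply: prode_ge0 => j _; apply: integral_ge0 => w _; exact: (hlikelihood _).2.
  rewrite le_eqVlt => /predU1P[<-|r0]; first by rewrite mul0e => /eqP; rewrite onee_eq0.
  by rewrite gt0_muley.
move=> /integrable_ae -/(_ measurableT); apply: filterS => t /(_ I).
by rewrite ge0_fin_numE.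
Qed.

(** On a rectangular event of the data, the [i]-th observation has density
    [evidence (fun=> 1)] up to a constant factor. *)
Lemma data_expectation_rectangle i (B : 'I_N -> set T) (q : T -> \bar R) :
  (forall j, measurable (B j)) -> nonneg_mfun q ->
  \int[P]_w (indicator R (rectangle B) (x w) * q (tnth (x w) i)) =
  others i B *
    \int[mT]_t (indicator R (B i) t * evidence (fun=> 1) t * q t).
Proof.
move=> mB hq.
have hB : nonneg_mfun (fun w => indicator R (rectangle B) (x w)).
  apply: (nonneg_mfun_comp _ (nonneg_mfun_indicator (measurable_rectangle mB))).
  exact: (measurable_funP x).
have hBe : nonneg_mfun (fun t => indicator R (B i) t * evidence (fun=> 1) t).
  by apply: nonneg_mfunM => //; exact: nonneg_mfun_indicator.
have o0 C : (forall j, measurable (C j)) -> 0 <= others i C.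
  move=> mC; apply: prode_ge0 => j _; apply: integral_ge0 => w _.
  exact: (hlikelihood _).2.
apply: (integral_like_eq
  (Phi := fun q => \int[P]_w (indicator R (rectangle B) (x w) * q (tnth (x w) i)))
  (Psi := fun q => others i B *
    \int[mT]_t (indicator R (B i) t * evidence (fun=> 1) t * q t))) => //.
- exact: integral_like_weighted.
- apply: integral_like_scale; first exact: o0.
  exact: (integral_like_weighted mT (X := id)).
move=> C mC; pose B' j := if j == i then B i `&` C else B j.
have mB' j : measurable (B' j) by rewrite /B'; case: ifP => // _; exact: measurableI.
have := @joint_law_rectangle i setT B' measurableT mB'.
have -> : others i B' = others i B.
  by apply: eq_bigr => j /negbTE ji; rewrite /B' ji.
rewrite indicator_setT {2}/B' eqxx.
under [in X in _ = X -> _]eq_integral do rewrite /indicator indicI EFinM muleAC.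
move=> <-.
rewrite -integral_indicator; last first.
  apply: measurableI; first exact: (@measurable_theta_pre i setT).
  exact: measurable_x_pre (measurable_rectangle mB').
apply: eq_integral => w _; rewrite /indicator -EFinM; congr EFin.
rewrite !indicE -natrM mulnb; congr (_%:R); congr nat_of_bool.
apply/andP/idP => [[/set_mem Bx /set_mem Cx]|/set_mem[_ B'x]].
  apply: mem_set; split => // j; rewrite /B' /=; case: eqP => [->|_].
    by split => //; exact: Bx.
  exact: Bx.
have := B'x i; rewrite /B' eqxx => -[_ Cx].
split; apply: mem_set => //= j; have := B'x j; rewrite /B'; case: eqP => [->[]|] //.
Qed.

(** The case of a vanishing marginal density is covered because the evidence of an
    event is at most that of the whole space. *)
Lemma evidence_posterior_mean A t : measurable A ->
  evidence (fun=> 1) t < +oo ->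
  evidence (fun=> 1) t * posterior_mean (indicator R A) t =
  evidence (indicator R A) t.
Proof.
move=> mA e1; rewrite /posterior_mean muleCA.
have e1_ge0 : 0 <= evidence (fun=> 1) t by exact: hevidence1.2.
have e1_fin : evidence (fun=> 1) t \is a fin_num by rewrite ge0_fin_numE.
have eA : 0 <= evidence (indicator R A) t <= evidence (fun=> 1) t.
  have hA := nonneg_mfun_indicator (R := R) mA.
  rewrite (nonneg_mfun_evidence hA).2/=.
  by apply: evidence_le => // v; rewrite /indicator lee_fin indicE; case: (_ \in _).
have [e0|e0] := eqVneq (evidence (fun=> 1) t) 0.
  by move: eA; rewrite e0 mul0e mule0 -eq_le => /eqP.
rewrite -{1}(fineK e1_fin) -EFinM divff ?mule1//.
by apply: contra e0 => /eqP f0; rewrite -(fineK e1_fin) f0.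
Qed.

(** Bayes' formula for an event [A].  It is checked on rectangles, where the
    factor [others] is common to both sides; both sides are finite measures in
    [B]. *)
Lemma joint_law_posterior_mean i (A : set V) (B : set (N.-tuple T)) :
  measurable A -> measurable B ->
  P ([set w | A (tnth (theta w) i)] `&` x @^-1` B) =
  \int[P]_w (indicator R B (x w) *
    posterior_mean (indicator R A) (tnth (x w) i)).
Proof.
move=> mA mB; have hA := nonneg_mfun_indicator (R := R) mA.
have mAi := measurable_theta_pre i mA.
have hq := nonneg_mfun_posterior_mean hA.
pose Phi (f : N.-tuple T -> \bar R) :=
  \int[P]_w (indicator R [set w | A (tnth (theta w) i)] w * f (x w)).
pose Psi (f : N.-tuple T -> \bar R) :=
  \int[P]_w (posterior_mean (indicator R A) (tnth (x w) i) * f (x w)).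
have PhiE C : measurable C ->
    Phi (indicator R C) = P ([set w | A (tnth (theta w) i)] `&` x @^-1` C).
  move=> mC; rewrite -integral_indicator.
    by apply: eq_integral => w _; rewrite /indicator indicI EFinM.
  by apply: measurableI => //; exact: measurable_x_pre.
have hPhi : integral_like Phi.
  by apply: integral_like_weighted => //; exact: nonneg_mfun_indicator.
have hPsi : integral_like Psi.
  by apply: integral_like_weighted => //; exact: (nonneg_mfun_comp _ hq).
rewrite -PhiE//; under eq_integral do rewrite muleC.
apply: (integral_like_unique (measurable_rectangles T N)
  (@setI_closed_rectangles _ T N) (@rectangles_setT _ T N) hPhi hPsi).
- move=> _ [C mC <-]; rewrite PhiE; last exact: measurable_rectangle.
  rewrite joint_law_rectangle// /Psi.
  under [RHS]eq_integral do rewrite muleC.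
  rewrite (data_expectation_rectangle i mC hq); congr (_ * _).
  have hC := nonneg_mfun_indicator (R := R) (mC i).
  apply: ae_eq_integral => //.
  + by have [] := nonneg_mfunM hC (nonneg_mfun_evidence hA).
  + by have [] := nonneg_mfunM (nonneg_mfunM hC hevidence1) hq.
  + have := evidence_ae_finite i; apply: filterS => t et _.
    by rewrite -muleA evidence_posterior_mean.
- rewrite (_ : (fun=> 1) = indicator R setT); last first.
    by apply/funext => y; rewrite /indicator indicT.
  by rewrite PhiE//; apply: le_lt_trans (probability_le1 _ _) (ltry 1) => //;
    apply: measurableI => //; rewrite preimage_setT.
- exact: nonneg_mfun_indicator.
Qed.

(** Both sides are integral-like in [h].  Extending in [B] first matters: for a
    general [h] the two sides may be infinite measures in [B], and agreement on
    rectangles would not suffice. *)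
Lemma expectation_posterior_mean i (h : V -> \bar R) (B : set (N.-tuple T)) :
  nonneg_mfun h -> measurable B ->
  \int[P]_w (indicator R B (x w) * h (tnth (theta w) i)) =
  \int[P]_w (indicator R B (x w) * posterior_mean h (tnth (x w) i)).
Proof.
move=> hh mB.
have hB : nonneg_mfun (fun w => indicator R B (x w)).
  exact: (nonneg_mfun_comp (X := x) _ (nonneg_mfun_indicator mB)).
apply: (integral_like_eq
  (Phi := fun h => \int[P]_w (indicator R B (x w) * h (tnth (theta w) i)))
  (Psi := fun h => \int[P]_w (indicator R B (x w) *
    posterior_mean h (tnth (x w) i)))) => //.
- exact: integral_like_weighted.
- apply: integral_like_mix => //.
  + move=> w _; apply: integral_like_scale; first exact: hB.2.
    rewrite /posterior_mean.
    under [X in integral_like X]eq_fun do rewrite muleC.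
    apply: integral_like_scale.
      by rewrite lee_fin invr_ge0 fine_ge0//; exact: hevidence1.2.
    rewrite /evidence.
    under [X in integral_like X]eq_fun do
      under eq_integral do rewrite -muleA muleC.
    apply: (integral_like_weighted mV (X := id)) => //.
    exact: nonneg_mfunM.
  + move=> f hf; apply: emeasurable_funM; first exact: hB.1.
    exact: (nonneg_mfun_comp (mx i) (nonneg_mfun_posterior_mean hf)).1.
move=> A mA; rewrite -joint_law_posterior_mean// -integral_indicator.
  by apply: eq_integral => w _; rewrite /indicator indicI EFinM muleC.
apply: measurableI; [exact: measurable_theta_pre|exact: measurable_x_pre].
Qed.

(** Any regular conditional distribution satisfies Bayes' formula: it has the same
    integrals as [posterior_mean h] over all events of the data. *)
Lemma posterior_expectation (post : R.-pker (N.-tuple T) ~> (N.-tuple V))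
    i (h : V -> \bar R) :
  conditional_distribution P theta x post ->
  nonneg_mfun h -> (forall t, posterior_mean h t < +oo) ->
  {ae P, forall w, \int[post (x w)]_v h (tnth v i) =
    posterior_mean h (tnth (x w) i)}.
Proof.
move=> hpost hh fin.
have hhi : nonneg_mfun (fun v : N.-tuple V => h (tnth v i)).
  exact: (nonneg_mfun_comp (measurable_tnth i) hh).
have hpostf (f : N.-tuple V -> \bar R) : nonneg_mfun f ->
    nonneg_mfun (fun y => \int[post y]_v f v).
  move=> [mf f0]; split=> [|y]; last exact: integral_ge0.
  apply: measurable_fun_integral_kernel => // U mU.
  exact: measurable_kernel.
have hq : nonneg_mfun (fun y : N.-tuple T => posterior_mean h (tnth y i)).
  exact: (nonneg_mfun_comp (measurable_tnth i) (nonneg_mfun_posterior_mean hh)).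
have post_expectation B : measurable B -> forall f, nonneg_mfun f ->
    \int[P]_w (indicator R B (x w) * f (theta w)) =
    \int[P]_(w in x @^-1` B) \int[post (x w)]_v f v.
  move=> mB.
  apply: (integral_like_eq
    (Phi := fun f => \int[P]_w (indicator R B (x w) * f (theta w)))
    (Psi := fun f => \int[P]_(w in x @^-1` B) \int[post (x w)]_v f v)).
  - apply: integral_like_weighted => //.
    exact: (nonneg_mfun_comp (X := x) _ (nonneg_mfun_indicator mB)).
  - apply: integral_like_mix; first exact: measurable_x_pre.
      by move=> w _; exact: integral_like_measure.
    move=> f hf; apply: measurable_funTS.
    exact: (nonneg_mfun_comp (X := x) _ (hpostf _ hf)).1.
  move=> A mA; under [RHS]eq_integral do rewrite integral_indicator//.
  rewrite -hpost// -integral_indicator.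
    by apply: eq_integral => w _; rewrite /indicator indicI EFinM muleC.
  apply: measurableI; last exact: measurable_x_pre.
  by rewrite -[X in measurable X]setTI; exact: (measurable_funP theta).
have : {ae distribution P x, forall y,
    \int[post y]_v h (tnth v i) = posterior_mean h (tnth y i)}.
  apply: ae_eq_of_integrals => //; first exact: hpostf.
  move=> E mE.
  rewrite !ge0_integral_pushforward//; first last.
  - by move=> y _; exact: (hpostf _ hhi).2.
  - by apply: measurable_funTS; exact: (hpostf _ hhi).1.
  - by move=> y _; exact: hq.2.
  - by apply: measurable_funTS; exact: hq.1.
  rewrite -post_expectation// expectation_posterior_mean//.
  rewrite [RHS]integral_mkcond; apply: eq_integral => w _.
  rewrite patchE /indicator indicE; case: ifPn.
    by rewrite inE/= => xE; rewrite mem_set// mul1e.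
  by rewrite notin_setE/= => xE; rewrite memNset// mul0e.
move=> [A [mA A0 subA]]; exists (x @^-1` A); split.
- exact: measurable_x_pre.
- exact: A0.
- by move=> w /= xw; apply: subA.
Qed.

End bayes_formula.

(** * Tail integrals of affine functions times an exponential *)

Section exponential_tail.
Context {R : realType}.
Implicit Types (A B b t : R).

Definition affine_exp A B b t := (A + B * t) * expR (- (b * t)).

Lemma is_derive_affine_exp A B b t :
  is_derive t (1 : R) (affine_exp A B b) (affine_exp (B - b * A) (- (b * B)) b t).
Proof.
have d1 : is_derive t (1 : R) (fun s : R => A + B * s) B.
  apply: is_derive_eq; rewrite add0r.
  by rewrite mul1r /GRing.scale/= mulr1.
have d2 : is_derive t (1 : R) (fun s => expR (- (b * s))) (- b * expR (- (b * t))).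
  by apply: is_derive_eq; rewrite /GRing.scale/= mulr1 mulrC.
apply: is_derive_eq; rewrite /GRing.scale/= /affine_exp; ring.
Qed.

Lemma continuous_affine_exp A B b : continuous (affine_exp A B b).
Proof.
move=> t; apply: differentiable_continuous; apply/derivable1_diffP.
by have [] := is_derive_affine_exp A B b t.
Qed.

Lemma cvg_expR_rate b : 0 < b -> expR (- (b * t)) @[t --> +oo] --> 0.
Proof.
move=> b0; apply: (@cvg_comp _ _ _ (fun t => b * t) (fun z => expR (- z)) _
  (pinfty_nbhs R)); last exact: cvgr_expR.
exact: gt0_cvgMry.
Qed.

(** Half of the exponential decay absorbs the linear factor. *)
Lemma cvg_affine_exp A B b : 0 <= A -> 0 <= B -> 0 < b ->
  affine_exp A B b t @[t --> +oo] --> 0.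
Proof.
move=> A0 B0 b0.
have b20 : 0 < b / 2 by rewrite divr_gt0.
apply: (@squeeze_cvgr _ _ _ _ (cst 0) (fun t => (A + B / (b / 2)) * expR (- (b / 2 * t)))).
- near=> t.
  have t0 : 0 < t by near: t; exact: nbhs_pinfty_gt.
  have e0 : 0 < expR (- (b / 2 * t)) by exact: expR_gt0.
  have bt : b / 2 * t <= expR (b / 2 * t).
    by apply: le_trans (expR_ge1Dx _); rewrite lerDr.
  rewrite /affine_exp; apply/andP; split.
    by rewrite mulr_ge0 ?expR_ge0// addr_ge0// mulr_ge0// ltW.
  have -> : - (b * t) = - (b / 2 * t) + - (b / 2 * t) by field.
  rewrite expRD mulrA ler_pM2r// [leLHS]mulrDl lerD//.
    rewrite ler_piMr// -[leRHS]expR0 ler_expR oppr_le0.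
    by rewrite mulr_ge0// ltW.
  rewrite -mulrA ler_wpM2l// expRN ler_pdivrMr ?expR_gt0// mulrC ler_pdivlMr//.
  by rewrite mulrC.
- exact: cvg_cst.
- rewrite -[X in _ --> X](mulr0 (A + B / (b / 2))).
  by apply: cvgM; [exact: cvg_cst|exact: cvg_expR_rate].
Unshelve. all: end_near. Qed.

(** The right-hand side is minus an antiderivative: this family of functions is
    closed under differentiation by [is_derive_affine_exp], and its new
    coefficients solve [B' - b * A' = - A] and [b * B' = B]. *)
Lemma integral_affine_exp A B b x : 0 <= A -> 0 <= B -> 0 < b -> 0 <= x ->
  (\int[leb]_(t in `]x, +oo[) (affine_exp A B b t)%:E =
  (affine_exp (A / b + B / b ^+ 2) (B / b) b x)%:E)%E.
Proof.
move=> A0 B0 b0 x0.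
have cont : {within `[x, +oo[, continuous (affine_exp A B b)}.
  exact/continuous_subspaceT/continuous_affine_exp.
have mf (D : set R) : measurable D -> measurable_fun D (fun t => (affine_exp A B b t)%:E).
  move=> mD; apply/measurable_EFinP; apply: measurable_funTS.
  by apply: continuous_measurable_fun; exact: continuous_affine_exp.
rewrite integral_itv_obnd_cbnd; last exact: mf.
set A' := _ + _; set B' := _ / b.
have dF t : is_derive t (1 : R) (fun t => - affine_exp A' B' b t) (affine_exp A B b t).
  have d := is_derive_affine_exp A' B' b t.
  apply: is_derive_eq; rewrite /affine_exp /A' /B'; field.
  by rewrite gt_eqF.
rewrite (@ge0_continuous_FTC2y _ _ (fun t => - affine_exp A' B' b t) _ 0)//.
- by rewrite sub0e EFinN oppeK.
- move=> t xt; rewrite mulr_ge0 ?expR_ge0// addr_ge0// mulr_ge0//.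
  exact: le_trans xt.
- rewrite -oppr0; apply: cvgN; apply: cvg_affine_exp => //.
  + by rewrite addr_ge0 ?divr_ge0 ?exprn_ge0 ?(ltW b0).
  + by rewrite divr_ge0// ltW.
- apply: cvgN; apply/cvg_at_right_filter; exact: continuous_affine_exp.
- by move=> t _; rewrite derive1E; have [_ ->] := dF t.
Qed.

End exponential_tail.

(** * Stieltjes measures with a density *)

Section stieltjes.
Local Open Scope ereal_scope.
Context {R : realType}.

Lemma lebesgue_stieltjes_measure_itvoc (F : cumulative R R) (a b : R) :
  (a <= b)%R -> lebesgue_stieltjes_measure F `]a, b] = (F b - F a)%:E.
Proof.
move=> ab; rewrite /lebesgue_stieltjes_measure /measure_extension/=.
rewrite measurable_mu_extE/=; last exact: is_ocitv.
by rewrite wlength_itv_bnd// EFinB.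
Qed.

(** The Stieltjes measure is determined by its values on the intervals [`]a, b]],
    where the density gives the increments of [F]. *)
Lemma integral_lebesgue_stieltjes_density (F : cumulative R R)
    (f q : measurableTypeR R -> \bar R) :
  nonneg_mfun f -> nonneg_mfun q ->
  (forall t, (t <= 0)%R -> f t = 0) ->
  (forall b, (F b)%:E = \int[leb]_(t in `]0%R, b]) f t) ->
  \int[lebesgue_stieltjes_measure F]_t q t = \int[leb]_t (f t * q t).
Proof.
move=> hf hq f_neg hF.
have hPsi := integral_like_weighted leb hf (@measurable_id _ _ setT).
have hPhi := integral_like_measure (lebesgue_stieltjes_measure F).
refine (integral_like_eq hPhi hPsi _ hq).
have [nu nuE] := integral_like_measureE hPsi.
have fI (A : set (measurableTypeR R)) : measurable A ->
    \int[leb]_t (f t * indicator R A t) = \int[leb]_(t in A) f t.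
  move=> mA; rewrite [RHS]integral_mkcond; apply: eq_integral => t _.
  rewrite patchE /indicator indicE; by case: ifPn; rewrite ?mule1 ?mule0.
move=> A mA; rewrite integral_indicator// -nuE//.
apply: lebesgue_stieltjes_measure_unique => // _ [[a b] _ <-]/=.
have [ab|/ltW ba] := leP a b; last first.
  by rewrite set_itv_ge ?measure0// bnd_simp -leNgt.
rewrite lebesgue_stieltjes_measure_itvoc// nuE// fI//.
have mf (D : set (measurableTypeR R)) : measurable_fun D f.
  exact: measurable_funTS hf.1.
have Fsplit : (F b)%:E = (F a)%:E + \int[leb]_(t in `]a, b]) f t.
  have negI (c : R) : \int[leb]_(t in `]0%R, c]) f t =
      \int[leb]_(t in `]-oo, c]) f t.
    rewrite [LHS]integral_mkcond [RHS]integral_mkcond.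
    apply: eq_integral => t _; rewrite !patchE !mem_setE !in_itv/=.
    by have [t0|t0]//= := ltP 0%R t; rewrite f_neg//; case: ifP.
  rewrite !hF !negI -ge0_integral_setU//.
  - by rewrite -itv_bndbnd_setU// bnd_simp.
  - by move=> t _; exact: hf.2.
  - by apply/disj_setPRL => t/=; rewrite !in_itv/= => /andP[at_ _]; apply/negP; rewrite -ltNge.
by rewrite EFinB Fsplit addeAC subee// add0e.
Qed.

End stieltjes.

(** * The likelihood of a variance *)

Section scaled_chi_square.
Context {R : realType} (k : nat).
Hypothesis k_gt0 : (0 < k)%N.
Local Notation a := (k%:R / 2 : R).

Let a_gt0 : 0 < a.
Proof. by rewrite divr_gt0// ltr0n. Qed.

(** The factor of the density that depends on the variance only.  Inverses are
    written as powers of exponent [-1], which are measurable on the line. *)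
Definition scale_weight (v : R) : R :=
  k%:R * k%:R `^ (a - 1) / (2 `^ a * gamma_function a) *
  (v `^ (- (a - 1)) * v `^ (-1)).

Lemma sample_var_pdfE (v t : R) : 0 < v -> 0 < t ->
  sample_var_pdf k v t =
  scale_weight v * t `^ (a - 1) * expR (- (a * v `^ (-1) * t)).
Proof.
move=> v0 t0; rewrite /sample_var_pdf /chi_square_pdf /scale_weight.
rewrite powRM; [|by rewrite mulr_ge0 ?ler0n// ltW|by rewrite invr_ge0 ltW].
rewrite powRM ?ler0n ?(ltW t0)//.
rewrite -[v^-1 `^ _](_ : v `^ (- (a - 1)) = _); last first.
  by rewrite -[v^-1]powR_inv1 ?ltW// -powRrM mulN1r.
rewrite powR_inv1 ?ltW//.
have -> : - (k%:R * t / v) / 2 = - (a * v^-1 * t) by ring.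
ring.
Qed.

Lemma gamma_function_ge0 (b : R) : 0 <= gamma_function b.
Proof.
apply: fine_ge0; apply: integral_ge0 => t _.
by rewrite lee_fin mulr_ge0 ?powR_ge0 ?expR_ge0.
Qed.

Lemma scale_weight_ge0 v : 0 <= scale_weight v.
Proof.
by rewrite /scale_weight !mulr_ge0 ?invr_ge0 ?mulr_ge0 ?powR_ge0 ?ler0n
  ?gamma_function_ge0.
Qed.

(** The sampling density extended by zero outside of the positive quadrant: this
    extension is nonnegative and measurable on the whole plane, as Tonelli's
    theorem requires. *)
Definition likelihood (z : measurableTypeR R * measurableTypeR R) : R :=
  \1_(`]0, +oo[) z.1 * \1_(`]0, +oo[) z.2 *
  (scale_weight z.1 * z.2 `^ (a - 1) * expR (- (a * z.1 `^ (-1) * z.2))).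

Lemma likelihoodE v t : 0 < v -> 0 < t ->
  likelihood (v, t) = sample_var_pdf k v t.
Proof.
move=> v0 t0; rewrite sample_var_pdfE// /likelihood/= !indicE !mem_set/= ?in_itv/= ?v0 ?t0//.
by rewrite !mul1r.
Qed.

Lemma likelihood_le0l v t : v <= 0 -> likelihood (v, t) = 0.
Proof.
by move=> v0; rewrite /likelihood/= indicE memNset ?mul0r//= in_itv/= ltNge v0.
Qed.

Lemma likelihood_le0r v t : t <= 0 -> likelihood (v, t) = 0.
Proof.
by move=> t0; rewrite /likelihood/= [\1__ t]indicE memNset ?mulr0 ?mul0r//= in_itv/= ltNge t0.
Qed.

Lemma likelihood_ge0 z : 0 <= likelihood z.
Proof.
apply: mulr_ge0; first by rewrite !indicE mulr_ge0.
by rewrite mulr_ge0 ?expR_ge0// mulr_ge0 ?scale_weight_ge0 ?powR_ge0.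
Qed.

Lemma nonneg_mfun_likelihood : nonneg_mfun (fun z => (likelihood z)%:E).
Proof.
split=> [|z]; last by rewrite lee_fin likelihood_ge0.
apply/measurable_EFinP.
have m1 : measurable_fun setT (fun z : measurableTypeR R * measurableTypeR R => z.1).
  exact: measurable_fst.
have m2 : measurable_fun setT (fun z : measurableTypeR R * measurableTypeR R => z.2).
  exact: measurable_snd.
have mp r : measurable_fun setT (fun x : measurableTypeR R => (x `^ r : measurableTypeR R)).
  exact: measurable_powR.
have mp1 r : measurable_fun setT
    (fun z : measurableTypeR R * measurableTypeR R => z.1 `^ r).
  exact: measurableT_comp (mp r) m1.
have mp2 r : measurable_fun setT
    (fun z : measurableTypeR R * measurableTypeR R => z.2 `^ r).
  exact: measurableT_comp (mp r) m2.
have mi : measurable_fun setT (\1_(`]0, +oo[) : measurableTypeR R -> R).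
  exact: measurable_indic.
apply: measurable_funM.
  by apply: measurable_funM; [exact: measurableT_comp mi m1|exact: measurableT_comp mi m2].
apply: measurable_funM.
  apply: measurable_funM => //; apply: measurable_funM => //.
  exact: measurable_funM.
apply: measurableT_comp => //; apply: measurableT_comp => //.
by apply: measurable_funM => //; apply: measurable_funM.
Qed.

(** The power of [t] cancels that of the density and leaves an affine function
    times an exponential of rate [a / v].  The absolute value makes the formula
    true for [v <= 0] as well, where both sides vanish. *)
Lemma likelihood_tail (v x c0 c1 : R) : 0 < x -> 0 <= c0 -> 0 <= c1 ->
  (\int[leb]_t (indicator R `]x, +oo[ t *
      ((c0 + c1 * t) * t `^ (- (a - 1)))%:E * (likelihood (v, t))%:E) =
   (x `^ (- (a - 1)) * ((c0 + c1 * x) / a * `|v| + c1 / a ^+ 2 * v ^+ 2) *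
     likelihood (v, x))%:E)%E.
Proof.
move=> x0 c00 c10; have [v0|v0] := leP v 0.
  rewrite likelihood_le0l// mulr0; apply: integral0_eq => t _.
  by rewrite likelihood_le0l// mule0.
have powRK t : 0 < t -> t `^ (- (a - 1)) * t `^ (a - 1) = 1.
  by move=> t0; rewrite powRN mulVf// gt_eqF// powR_gt0.
have vN0 : v != 0 by rewrite gt_eqF.
have av0 : 0 < a / v by rewrite divr_gt0.
transitivity (\int[leb]_(t in `]x, +oo[)
    ((scale_weight v)%:E * (affine_exp c0 c1 (a / v) t)%:E))%E.
  rewrite [RHS]integral_mkcond; apply: eq_integral => t _.
  rewrite patchE /indicator indicE; case: ifPn => tx; last by rewrite !mul0e.
  rewrite mul1e -!EFinM; congr EFin.
  have t0 : 0 < t.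
    by move: tx; rewrite inE/= in_itv/= andbT; exact: lt_trans.
  rewrite likelihoodE// sample_var_pdfE// powR_inv1 ?ltW// /affine_exp.
  rewrite -[RHS]mulr1 -[X in _ = _ * X](powRK _ t0); ring.
rewrite ge0_integralZl//; last 3 first.
- apply/measurable_EFinP; apply: measurable_funTS.
  by apply: continuous_measurable_fun; exact: continuous_affine_exp.
- move=> t; rewrite /= in_itv/= andbT => xt; rewrite lee_fin mulr_ge0 ?expR_ge0//.
  by rewrite addr_ge0// mulr_ge0// ltW// (lt_trans x0).
- by rewrite lee_fin scale_weight_ge0.
rewrite integral_affine_exp// ?(ltW x0)// -EFinM; congr EFin.
rewrite likelihoodE// sample_var_pdfE// powR_inv1 ?ltW// /affine_exp (gtr0_norm v0).
transitivity (scale_weight v * ((c0 / (a / v) + c1 / (a / v) ^+ 2 + c1 / (a / v) * x) *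
    expR (- (a / v * x))) * (x `^ (- (a - 1)) * x `^ (a - 1))).
  by rewrite powRK// mulr1.
have -> : c0 / (a / v) + c1 / (a / v) ^+ 2 + c1 / (a / v) * x =
    (c0 + c1 * x) / a * v + c1 / a ^+ 2 * v ^+ 2.
  by field; rewrite vN0 pnatr_eq0 -lt0n k_gt0.
ring.
Qed.

End scaled_chi_square.

(** * The marginal law and its tail integrals *)

Section variance_model.
Local Open Scope ereal_scope.
Context {R : realType} (k : nat) (k_gt0 : (0 < k)%N) (g : R -> R)
  (hg : prior_density g).
Local Notation a := (k%:R / 2 : R)%R.
Local Notation D := (`]0%R, +oo[%classic : set (measurableTypeR R)).

(** Extended by zero, since [g] is constrained on the positive half-line only. *)
Definition prior (v : measurableTypeR R) : \bar R := ((g \_ D) v)%:E.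

Definition var_evidence : (measurableTypeR R -> \bar R) -> measurableTypeR R -> \bar R :=
  evidence leb (fun z => (likelihood k z)%:E) prior.

Lemma nonneg_mfun_prior : nonneg_mfun prior.
Proof.
split=> [|v].
  apply/measurable_EFinP.
  have mD : measurable D by exact: measurable_itv.
  have [+ _] := @measurable_restrictT _ _ _ (measurableTypeR R) D g mD.
  by apply; exact: prior_measurable.
rewrite lee_fin patchE; case: ifPn => //; rewrite inE/= in_itv/= andbT.
exact: (prior_ge0 hg).
Qed.

Let hlik := nonneg_mfun_likelihood k (R := R).

Lemma marginal_pdfE (t : R) : (0 < t)%R ->
  marginal_pdf k g t = var_evidence (fun=> 1) t.
Proof.
move=> t0; rewrite /marginal_pdf integral_mkcond.
apply: eq_integral => v _; rewrite patchE mul1e /prior patchE.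
case: ifPn => [|_]; last by rewrite mul0e.
by rewrite inE/= in_itv/= andbT => v0; rewrite likelihoodE// -EFinM mulrC.
Qed.

Lemma var_evidence_le0 h (t : R) : (t <= 0)%R -> var_evidence h t = 0.
Proof.
by move=> t0; apply: integral0_eq => v _; rewrite likelihood_le0r// mule0.
Qed.

Lemma integral_cdf (F : cumulative R R) (q : measurableTypeR R -> \bar R) :
  marginal_cdf k g F -> nonneg_mfun q ->
  \int[lebesgue_stieltjes_measure F]_t q t =
  \int[leb]_t (q t * var_evidence (fun=> 1) t).
Proof.
move=> hF hq.
rewrite (@integral_lebesgue_stieltjes_density _ _ (var_evidence (fun=> 1)))//.
- by apply: eq_integral => t _; rewrite muleC.
- apply: nonneg_mfun_evidence => //; exact: nonneg_mfun_prior.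
- by move=> t; exact: var_evidence_le0.
- move=> b; rewrite hF; apply: eq_integral => t.
  by rewrite inE/= in_itv/= => /andP[t0 _]; exact: marginal_pdfE.
Qed.

Let nonneg_mfun_EFin (h : measurableTypeR R -> R) :
  measurable_fun setT h -> (forall v, 0 <= h v)%R ->
  nonneg_mfun (fun v => (h v)%:E).
Proof. by move=> mh h0; split => [|v]; [exact/measurable_EFinP|rewrite lee_fin]. Qed.

Local Notation abs_fun := (fun v : measurableTypeR R => (`|v|%R)%:E).
Local Notation sqr_fun := (fun v : measurableTypeR R => (v ^+ 2)%:E).

Lemma nonneg_mfun_abs : nonneg_mfun abs_fun.
Proof. exact: nonneg_mfun_EFin. Qed.

Lemma nonneg_mfun_sqr : nonneg_mfun sqr_fun.
Proof. by apply: nonneg_mfun_EFin => // v; rewrite sqr_ge0. Qed.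

Lemma nonneg_mfun_abs_sub :
  nonneg_mfun (fun v : measurableTypeR R => (`|v| - v)%:E).
Proof.
apply: nonneg_mfun_EFin => [|v]; first exact: measurable_funB.
by rewrite subr_ge0 ler_norm.
Qed.

Lemma nonneg_mfun_evidence_integrand (x : R) h : nonneg_mfun h ->
  nonneg_mfun (fun v => h v * prior v *
    (likelihood k (v, x : measurableTypeR R))%:E).
Proof.
move=> hh; apply: nonneg_mfunM.
  by apply: nonneg_mfunM => //; exact: nonneg_mfun_prior.
apply: (nonneg_mfun_comp (X := fun v => (v, x : measurableTypeR R)) _ hlik).
exact: measurable_fun_pair.
Qed.

(** The heart of the matter: a tail integral of the marginal law with the
    exponents of the theorem is a combination of the first two unnormalized
    posterior moments at [x]. *)
Lemma tail_moment (F : cumulative R R) (x c0 c1 : R) :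
  marginal_cdf k g F -> (0 < x)%R -> (0 <= c0)%R -> (0 <= c1)%R ->
  \int[lebesgue_stieltjes_measure F]_(t in `]x, +oo[)
    ((c0 + c1 * t) * t `^ (- (a - 1)))%R%:E =
  (x `^ (- (a - 1)))%R%:E *
    (((c0 + c1 * x) / a)%:E * var_evidence (fun v => `|v|%:E) x +
     (c1 / a ^+ 2)%:E * var_evidence (fun v => (v ^+ 2)%:E) x).
Proof.
move=> hF x0 c00 c10.
pose q (t : measurableTypeR R) := indicator R `]x, +oo[ t *
  ((c0 + c1 * (t : R)) * (t : R) `^ (- (a - 1)))%R%:E.
have hq : nonneg_mfun q.
  split=> [|t].
    apply: emeasurable_funM; first exact/measurable_EFinP/measurable_indic.
    apply/measurable_EFinP/measurable_funM; last exact: measurable_powR.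
    by apply: measurable_funD => //; exact: measurable_funM.
  rewrite /q /indicator indicE; case: (boolP (t \in _)) => [|_]; last by rewrite mul0e.
  rewrite inE/= in_itv/= andbT mul1e lee_fin => xt.
  rewrite mulr_ge0 ?powR_ge0// addr_ge0// mulr_ge0// ltW//.
  exact: lt_trans xt.
rewrite integral_mkcond (_ : _ \_ _ = q); last first.
  apply/funext => t; rewrite patchE /q /indicator indicE.
  by case: ifPn; rewrite ?mul1e ?mul0e.
rewrite integral_cdf//.
rewrite evidence_tonelli//; last exact: nonneg_mfun_prior.
have m := nonneg_mfun_evidence_integrand x.
have [m1 m1_ge0] := m _ nonneg_mfun_abs.
have [m2 m2_ge0] := m _ nonneg_mfun_sqr.
have d1 : (0 <= (c0 + c1 * x) / a)%R.
  by rewrite divr_ge0// addr_ge0// mulr_ge0// ltW.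
have d2 : (0 <= c1 / a ^+ 2)%R by rewrite divr_ge0// sqr_ge0.
rewrite /var_evidence /evidence -!ge0_integralZl_EFin// -ge0_integralD//; first last.
- exact: measurable_funeM.
- by move=> v _; rewrite mule_ge0.
- exact: measurable_funeM.
- by move=> v _; rewrite mule_ge0.
rewrite -ge0_integralZl_EFin ?powR_ge0//; first last.
- by apply: emeasurable_funD; exact: measurable_funeM.
- by move=> v _; rewrite adde_ge0// mule_ge0.
apply: eq_integral => v _; rewrite mul1e likelihood_tail//.
rewrite /prior -!EFinM; congr EFin; ring.
Qed.

Lemma nonneg_mfun_var_evidence h :
  nonneg_mfun h -> nonneg_mfun (var_evidence h).
Proof. by move=> hh; exact: nonneg_mfun_evidence nonneg_mfun_prior _ hh. Qed.

(** The posterior charges positive variances only, so the first moment may be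
    computed with [`|v|], which is a nonnegative function on the whole line. *)
Lemma var_evidence_abs_sub (x : R) :
  var_evidence (fun v : measurableTypeR R => (`|v| - v)%:E) x = 0.
Proof.
apply: integral0_eq => v _; have [v0|v0] := leP v 0%R.
  by rewrite likelihood_le0l// mule0.
by rewrite gtr0_norm// subrr !mul0e.
Qed.

(** Used in contrapositive form: where the marginal density is positive, so are
    the posterior moments. *)
Lemma var_evidence_eq0 h (x : R) : nonneg_mfun h ->
  (forall v : R, (0 < v)%R -> h v != 0) ->
  var_evidence h x = 0 -> var_evidence (fun=> 1) x = 0.
Proof.
move=> hh h_neq0 ev0.
have m := nonneg_mfun_evidence_integrand x.
have [mh h0] := m _ hh.
have [mone _] := m _ (nonneg_mfun_cst (measurableTypeR R) (@lee01 R)).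
have /(ae_eq_integral_abs leb measurableT mh) aeh :
    \int[leb]_v `|h v * prior v * (likelihood k (v, x))%:E| = 0.
  by rewrite -[RHS]ev0; apply: eq_integral => v _; rewrite gee0_abs.
rewrite -(integral0 leb setT); apply: ae_eq_integral => //.
apply: filterS aeh => v /[apply]/eqP; rewrite mule_eq0 mule_eq0.
have [v0|v0] := leP v 0%R; first by rewrite likelihood_le0l// mule0.
rewrite (negbTE (h_neq0 v v0)) orFb => /orP[/eqP->|/eqP->].
  by rewrite mule0 mul0e.
by rewrite mule0.
Qed.

Section tails.
Context (F : cumulative R R) (hF : marginal_cdf k g F).
Hypothesis hint2 : \int[lebesgue_stieltjes_measure F]_(t in `]0%R, +oo[)
  (t `^ (- (a - 2)))%R%:E < +oo.
Hypothesis hint1 : \int[lebesgue_stieltjes_measure F]_(t in `]0%R, +oo[)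
  (t `^ (- (a - 1)))%R%:E < +oo.

Let a_gt0 : (0 < a)%R.
Proof. by rewrite divr_gt0// ltr0n. Qed.

Definition tail_integral (r x : R) : \bar R :=
  \int[lebesgue_stieltjes_measure F]_(t in `]x, +oo[) (t `^ r)%R%:E.

Lemma tail_integral1E (x : R) : (0 < x)%R -> tail_integral (- (a - 1)) x =
  (x `^ (- (a - 1)) / a)%R%:E * var_evidence abs_fun x.
Proof.
move=> x0; have := tail_moment hF x0 ler01 (lexx 0%R).
rewrite !mul0r mul0e adde0 addr0 muleA -EFinM mul1r => <-.
by apply: eq_integral => t _; rewrite mul0r addr0 mul1r.
Qed.

Lemma tail_integral2E (x : R) : (0 < x)%R -> tail_integral (- (a - 2)) x =
  (x `^ (- (a - 1)))%R%:E *
    ((x / a)%:E * var_evidence abs_fun x + (a ^- 2)%:E * var_evidence sqr_fun x).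
Proof.
move=> x0; have := tail_moment hF x0 (lexx 0%R) ler01.
rewrite add0r !mul1r => <-; apply: eq_integral => t.
rewrite inE/= in_itv/= andbT => /(lt_trans x0) t0; congr EFin.
rewrite add0r mul1r (_ : - (a - 2) = 1 + - (a - 1))%R; last by ring.
by rewrite powRD ?(gt_eqF t0) ?implybT// powRr1// ltW.
Qed.

Let tail_integral_lty (r x : R) : (0 < x)%R ->
  \int[lebesgue_stieltjes_measure F]_(t in `]0%R, +oo[) (t `^ r)%R%:E < +oo ->
  tail_integral r x < +oo.
Proof.
move=> x0; apply: le_lt_trans; apply: ge0_subset_integral => //.
- by apply/measurable_EFinP; apply: measurable_funTS; exact: measurable_powR.
- by move=> t _; rewrite lee_fin powR_ge0.
- by apply: subset_itvr; rewrite bnd_simp ltW.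
Qed.

Lemma var_evidence_abs_lty (x : R) : var_evidence abs_fun x < +oo.
Proof.
have [x0|x0] := ltP 0%R x; last by rewrite var_evidence_le0.
have tail_lty := tail_integral_lty x0 hint1.
rewrite (tail_integral1E x0) in tail_lty.
rewrite ltey; apply/eqP => ev_inf; move: tail_lty.
by rewrite ev_inf gt0_muley// lte_fin divr_gt0// powR_gt0.
Qed.

Lemma var_evidence_sqr_lty (x : R) : var_evidence sqr_fun x < +oo.
Proof.
have [x0|x0] := ltP 0%R x; last by rewrite var_evidence_le0.
have tail_lty := tail_integral_lty x0 hint2.
rewrite (tail_integral2E x0) in tail_lty.
rewrite ltey; apply/eqP => ev_inf; move: tail_lty; rewrite ev_inf.
have A0 : 0 <= (x / a)%:E * var_evidence abs_fun x.
  apply: mule_ge0; last exact: (nonneg_mfun_var_evidence nonneg_mfun_abs).2.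
  by rewrite lee_fin divr_ge0// ltW.
rewrite [X in (_ + X)%E]gt0_muley ?lte_fin ?invr_gt0 ?exprn_gt0//.
by rewrite addey ?gt0_muley ?lte_fin ?powR_gt0// -ltNye (lt_le_trans _ A0).
Qed.

Lemma tail_ratioE (x m1 m2 : R) : (0 < x)%R -> (m1 != 0)%R ->
  var_evidence abs_fun x = m1%:E -> var_evidence sqr_fun x = m2%:E ->
  (a * (fine (tail_integral (- (a - 2)) x) /
        fine (tail_integral (- (a - 1)) x) - x) = m2 / m1)%R.
Proof.
move=> x0 m1N0 E1 E2; rewrite tail_integral2E// tail_integral1E// E1 E2.
rewrite -!EFinM/=; field.
have p0 : (x `^ (- (a - 1)) != 0)%R by rewrite gt_eqF// powR_gt0.
by rewrite m1N0 p0 pnatr_eq0 -lt0n k_gt0.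
Qed.

End tails.

End variance_model.

(** * The quadratic loss of a ratio *)

Section quadratic_loss.
Local Open Scope ereal_scope.
Context {R : realType}.

(** Expanding the square under the integral would involve the signed function
    [X].  Instead, [2 / u * `|X|] is added to the integrand, which makes it a sum of
    nonnegative functions with known integrals. *)
Lemma integral_square_ratio d (T : measurableType d)
  (mu : {measure set T -> \bar R}) (X : T -> measurableTypeR R) (e1 e2 u : R) :
  measurable_fun setT X -> mu setT = 1 -> (0 < u)%R ->
  \int[mu]_t (`|X t|)%:E = e1%:E -> \int[mu]_t (X t ^+ 2)%:E = e2%:E ->
  \int[mu]_t (`|X t| - X t)%:E = 0 ->
  \int[mu]_t ((X t / u - 1) ^+ 2)%:E = (e2 / u ^+ 2 - 2 * (e1 / u) + 1)%:E.
Proof.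
move=> mX mu1 u0 E1 E2 E3.
have mabs : measurable_fun setT (fun t => (`|X t|)%R : measurableTypeR R).
  exact: measurableT_comp.
have m1 : measurable_fun setT (fun t => (`|X t|)%:E) by exact/measurable_EFinP.
have m2 : measurable_fun setT (fun t => (X t ^+ 2)%:E).
  by apply/measurable_EFinP; exact: measurable_funX.
have m3 : measurable_fun setT (fun t => (`|X t| - X t)%:E).
  by apply/measurable_EFinP; exact: measurable_funB.
have m4 : measurable_fun setT (fun t => ((X t / u - 1) ^+ 2)%:E).
  apply/measurable_EFinP; apply: measurable_funX; apply: measurable_funB => //.
  exact: measurable_funM.
have abs_sub_ge0 t : (0 <= `|X t| - X t)%R by rewrite subr_ge0 ler_norm.
have u2_ge0 : (0 <= 2 / u)%R by rewrite divr_ge0// ltW.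
have iu2_ge0 : (0 <= (u ^+ 2)^-1)%R by rewrite invr_ge0 sqr_ge0.
have key : \int[mu]_t ((X t / u - 1) ^+ 2)%:E + (2 / u * e1)%:E =
    ((u ^+ 2)^-1 * e2)%:E + 1.
  transitivity (\int[mu]_t (((X t / u - 1) ^+ 2)%:E + (2 / u)%:E * (`|X t|)%:E)).
    rewrite ge0_integralD//.
    - by rewrite ge0_integralZl_EFin// E1.
    - by move=> t _; rewrite lee_fin sqr_ge0.
    - by move=> t _; rewrite mule_ge0.
    - exact: measurable_funeM.
  transitivity (\int[mu]_t (((u ^+ 2)^-1%:E * (X t ^+ 2)%:E + 1) +
      (2 / u)%:E * (`|X t| - X t)%:E)).
    apply: eq_integral => t _; rewrite -!EFinM -!EFinD; congr EFin; field.
    by rewrite gt_eqF.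
  have n1 t : 0 <= ((u ^+ 2)^-1)%:E * (X t ^+ 2)%:E.
    by rewrite mule_ge0// lee_fin ?sqr_ge0.
  rewrite ge0_integralD//; last 4 first.
  - by move=> t _; rewrite adde_ge0.
  - by apply: emeasurable_funD => //; exact: measurable_funeM.
  - by move=> t _; rewrite mule_ge0// lee_fin.
  - exact: measurable_funeM.
  rewrite ge0_integralD//; last exact: measurable_funeM.
  rewrite ge0_integralZl_EFin// ?E2; last by move=> t _; rewrite lee_fin sqr_ge0.
  rewrite ge0_integralZl_EFin// ?E3; last by move=> t _; rewrite lee_fin.
  by rewrite mule0 adde0 integral_cst// mu1 mule1.
move: key => /(congr1 (fun z => z - (2 / u * e1)%:E)).
rewrite addeK// => ->; rewrite -!EFinD; congr EFin; field.
by rewrite gt_eqF.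
Qed.

(** The difference is [e1 ^+ 2 / e2 * (1 - v / u) ^+ 2]. *)
Lemma quadratic_ratio_lt (e1 e2 u v : R) : (0 < e1)%R -> (0 < e2)%R ->
  (0 < u)%R -> v = (e2 / e1)%R -> u != v ->
  (e2 / v ^+ 2 - 2 * (e1 / v) + 1 < e2 / u ^+ 2 - 2 * (e1 / u) + 1)%R.
Proof.
move=> e10 e20 u0 -> uv; rewrite -subr_gt0.
have -> : (e2 / u ^+ 2 - 2 * (e1 / u) + 1 -
    (e2 / (e2 / e1) ^+ 2 - 2 * (e1 / (e2 / e1)) + 1) =
    (e1 ^+ 2 / e2 / u ^+ 2) * (u - e2 / e1) ^+ 2)%R.
  by field; rewrite !gt_eqF.
apply: mulr_gt0; first by rewrite !divr_gt0 ?exprn_gt0.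
by rewrite lt_def expf_eq0/= subr_eq0 uv sqr_ge0.
Qed.

End quadratic_loss.

(** * The hierarchical model *)

Section hierarchical_model.
Local Open Scope ereal_scope.
Context {R : realType} d (Omega : measurableType d) (P : probability Omega R)
  (k N : nat) (g : R -> R)
  (sigma2 s2 : {mfun Omega >-> vec R N}).
Hypotheses (k_gt0 : (0 < k)%N) (hg : prior_density g)
  (hmodel : hierarchical_model P k g sigma2 s2).
Local Notation a := (k%:R / 2 : R)%R.

Lemma variances_independent : independent_family P sigma2.
Proof. exact: variances_indep hmodel. Qed.

Lemma variance_prior_law i (A : set (measurableTypeR R)) : measurable A ->
  P [set w | A (tnth (sigma2 w) i)] = \int[leb]_v (indicator R A v * prior g v).
Proof.
move=> mA; rewrite (variances_law hmodel i mA) integral_mkcond.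
apply: eq_integral => v _; rewrite patchE /indicator indicE /prior patchE in_setI.
by case: (v \in A); case: (v \in _); rewrite ?mul1e ?mul0e.
Qed.

Lemma sample_var_lawE v (B : set (measurableTypeR R)) : (0 < v)%R ->
  sample_var_law k v B =
  \int[leb]_t (indicator R B t * (likelihood k (v, t))%:E).
Proof.
move=> v0; rewrite /sample_var_law integral_mkcond.
apply: eq_integral => t _; rewrite patchE /indicator indicE in_setI.
case: (t \in B); last by rewrite mul0e.
rewrite mul1e /=; case: (ltP 0%R t) => t0.
  by rewrite ifT ?likelihoodE// inE/= in_itv/= t0.
by rewrite ifF ?likelihood_le0r// memNset//= in_itv/= ltNge t0.
Qed.

Lemma positive_variances :
  P (sigma2 @^-1` rectangle (fun=> `]0%R, +oo[%classic)) = 1.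
Proof.
rewrite [LHS]variances_independent; last first.
  by move=> i; exact: measurable_itv.
apply: big1 => i _.
rewrite (variances_law hmodel)//.
by rewrite setIid (prior_total hg).
Qed.

(** The model specifies the conditional law of the samples by
    [sample_var_law], which coincides with the likelihood at positive variances.
    Restricting to the event, of probability one, that all variances are
    positive loses nothing: outside of it a factor of the product vanishes. *)
Lemma samples_rectangle_law (A : set (vec R N))
    (B : 'I_N -> set (measurableTypeR R)) :
  measurable A -> (forall i, measurable (B i)) ->
  P (sigma2 @^-1` A `&` s2 @^-1` rectangle B) =
  \int[P]_(w in sigma2 @^-1` A) \prod_(i < N)
    \int[leb]_t (indicator R (B i) t * (likelihood k (tnth (sigma2 w) i, t))%:E).
Proof.
move=> mA mB.
pose pos : set (vec R N) := rectangle (fun=> `]0%R, +oo[%classic).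
have mpos : measurable pos.
  by apply: measurable_rectangle => i; exact: measurable_itv.
have mpre (C : set (vec R N)) (X : {mfun Omega >-> vec R N}) :
    measurable C -> measurable (X @^-1` C).
  by move=> mC; rewrite -[X in measurable X]setTI; exact: (measurable_funP X).
have null : P (~` (sigma2 @^-1` pos)) = 0.
  by rewrite probability_setC ?positive_variances ?subee//; exact: mpre.
have mE : measurable (sigma2 @^-1` A `&` s2 @^-1` rectangle B).
  by apply: measurableI; apply: mpre => //; exact: measurable_rectangle.
rewrite (measureDI P mE (mpre _ sigma2 mpos)).
rewrite [X in X + _](_ : _ = 0) ?add0e; last first.
  apply/eqP; rewrite eq_le measure_ge0 andbT -null.
  apply: le_measure; rewrite ?inE.
  - by apply: measurableD => //; exact: mpre.
  - by apply: measurableC; exact: mpre.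
  - by move=> w [].
rewrite setIAC -preimage_setI.
rewrite [LHS](samples_cond_law hmodel (measurableI _ _ mA mpos) mB).
rewrite [LHS]integral_mkcond [RHS]integral_mkcond; apply: eq_integral => w _.
rewrite !patchE preimage_setI in_setI.
case: (boolP (w \in sigma2 @^-1` A)) => //= _.
case: ifPn => [|].
  rewrite inE => pos_w; apply: eq_bigr => i _; rewrite sample_var_lawE//.
  by have := pos_w i; rewrite /= in_itv/= andbT.
rewrite notin_setE => /existsNP[i]; rewrite /= in_itv/= andbT => /negP.
rewrite -leNgt => si; rewrite (bigD1 i)//= integral0_eq ?mul0e// => t _.
by rewrite likelihood_le0l// mule0.
Qed.

(** For almost all data, the estimator is the ratio of the second posterior moment
    to the first, and both are positive and finite.  The first moment [e1] is
    given through [`|v|] and the vanishing of [`|v| - v]. *)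
Lemma posterior_moments (F : cumulative R R) (post : R.-pker (vec R N) ~> (vec R N))
    (i : 'I_N) :
  marginal_cdf k g F ->
  \int[lebesgue_stieltjes_measure F]_(t in `]0%R, +oo[)
    (t `^ (- (a - 2)))%R%:E < +oo ->
  \int[lebesgue_stieltjes_measure F]_(t in `]0%R, +oo[)
    (t `^ (- (a - 1)))%R%:E < +oo ->
  conditional_distribution P sigma2 s2 post ->
  {ae P, forall w, exists e1 e2, [/\ (0 < e1)%R, (0 < e2)%R,
    [/\ \int[post (s2 w)]_v (`|tnth v i|)%:E = e1%:E,
      \int[post (s2 w)]_v (tnth v i ^+ 2)%:E = e2%:E &
      \int[post (s2 w)]_v (`|tnth v i| - tnth v i)%:E = 0] &
    tnth (F_bayes_estimator k F (s2 w)) i = (e2 / e1)%R]}.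
Proof.
move=> hF hint2 hint1 hpost.
pose mean h := posterior_mean leb (fun z => (likelihood k z)%:E) (prior g) h.
have ae_mean h : nonneg_mfun h -> (forall x, mean h x < +oo) ->
    {ae P, forall w, \int[post (s2 w)]_v h (tnth v i) = mean h (tnth (s2 w) i)}.
  move=> hh mean_lty.
  exact: (posterior_expectation (nonneg_mfun_likelihood k) (nonneg_mfun_prior hg)
    variances_independent variance_prior_law samples_rectangle_law i hpost hh mean_lty).
have mean_lty h : nonneg_mfun h -> (forall x, var_evidence k g h x < +oo) ->
    forall x, mean h x < +oo.
  move=> hh ev_lty x; rewrite /mean /posterior_mean.
  rewrite -/(var_evidence k g h x).
  have : var_evidence k g h x \is a fin_num.
    rewrite ge0_fin_numE; first exact: ev_lty.
    exact: (nonneg_mfun_var_evidence k hg hh).2.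
  by move=> /fineK <-; rewrite -EFinM ltry.
have none : nonneg_mfun (fun _ : measurableTypeR R => 1%:E : \bar R).
  by apply: nonneg_mfun_cst; rewrite lee_fin.
have mean_one x : mean (fun=> 1) x < +oo.
  rewrite /mean /posterior_mean -/(var_evidence k g (fun=> 1%E) x).
  case: (var_evidence k g _ x) => [r| |]; first by rewrite -EFinM ltry.
    by rewrite /= invr0 mule0.
  by rewrite /= invr0 mule0.
(* the case [h = 1] shows that the marginal density is neither 0 nor infinite *)
have ae1 := ae_mean _ none mean_one.
have ae_abs := ae_mean _ nonneg_mfun_abs
  (mean_lty _ nonneg_mfun_abs (var_evidence_abs_lty k_gt0 hg hF hint1)).
have ae_sqr := ae_mean _ nonneg_mfun_sqr
  (mean_lty _ nonneg_mfun_sqr (var_evidence_sqr_lty k_gt0 hg hF hint2)).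
have ae_sub := ae_mean _ nonneg_mfun_abs_sub
  (mean_lty _ nonneg_mfun_abs_sub (fun x => eq_ind_r (fun z => z < +oo) (ltry 0)
    (var_evidence_abs_sub k g x))).
have FP := ae_filter_ringOfSetsType P.
have := @filterI _ _ FP _ _ (@filterI _ _ FP _ _ ae1 ae_abs)
  (@filterI _ _ FP _ _ ae_sqr ae_sub).
apply: (@filterS _ _ FP) => w [[+ +] []].
set x := tnth (s2 w) i.
rewrite integral_cst// prob_kernel mule1 /mean /posterior_mean.
rewrite -!/(var_evidence k g _ x).
have ev1_ge0 := (nonneg_mfun_var_evidence k hg none).2 x.
case ev1 : (var_evidence k g (fun=> 1) x) ev1_ge0 => [m0| |//]; last first.
  by rewrite /= invr0 mule0 => _ /eqP; rewrite onee_eq0.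
rewrite lee_fin le_eqVlt => /predU1P[<-|m0_gt0].
  by rewrite mul0e => /eqP; rewrite onee_eq0.
have m0N0 : (m0 != 0)%R by rewrite gt_eqF.
have x_gt0 : (0 < x)%R.
  rewrite ltNge; apply: contra m0N0 => x_le0.
  by move: ev1; rewrite var_evidence_le0// => -[<-].
have moment h : nonneg_mfun h -> (forall v : R, (0 < v)%R -> h v != 0) ->
    var_evidence k g h x < +oo ->
    exists2 m, var_evidence k g h x = m%:E & (0 < m)%R.
  move=> hh hN0 ev_lty; have ev_ge0 := (nonneg_mfun_var_evidence k hg hh).2 x.
  exists (fine (var_evidence k g h x)); first by rewrite fineK// ge0_fin_numE.
  rewrite fine_gt0// ev_lty andbT lt_def ev_ge0 andbT.
  apply: contra m0N0 => /eqP /(var_evidence_eq0 (k := k) hg hh hN0).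
  by rewrite ev1 => -[->].
have [|m1 E1 m1_gt0] := moment _ nonneg_mfun_abs _
    (var_evidence_abs_lty k_gt0 hg hF hint1 x).
  by move=> v v0; rewrite eqe normr_eq0 gt_eqF.
have [|m2 E2 m2_gt0] := moment _ nonneg_mfun_sqr _
    (var_evidence_sqr_lty k_gt0 hg hF hint2 x).
  by move=> v v0; rewrite eqe gt_eqF// exprn_gt0.
move=> _; rewrite E1 E2 var_evidence_abs_sub mul0e/= -!EFinM => I1 I2 I3.
exists (m1 / m0)%R, (m2 / m0)%R; split => //; try exact: divr_gt0.
rewrite tnth_mktuple (tail_ratioE k_gt0 hg hF x_gt0 _ E1 E2) ?gt_eqF//.
by field; rewrite m0N0 gt_eqF.
Qed.

End hierarchical_model.

Theorem theorem2p3 (R : realType) (d : measure_display)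
    (Omega : measurableType d) (P : probability Omega R)
    (k N : nat) (hk : (0 < k)%N)
    (g : R -> R) (hg : prior_density g)
    (sigma2 s2 : {mfun Omega >-> vec R N})
    (hmodel : hierarchical_model P k g sigma2 s2)
    (F : cumulative R R) (hF : marginal_cdf k g F)
    (hint2 : (\int[lebesgue_stieltjes_measure F]_(t in `]0%R, +oo[)
                (t `^ (- (k%:R / 2 - 2)))%:E < +oo)%E)
    (hint1 : (\int[lebesgue_stieltjes_measure F]_(t in `]0%R, +oo[)
                (t `^ (- (k%:R / 2 - 1)))%:E < +oo)%E) :
  bayes_rule P sigma2 s2 (@loss1 R N) (F_bayes_estimator k F).
Proof.
move=> post hpost.
have FP := ae_filter_ringOfSetsType P.
have := @filter_forall _ _ _ _ FP
  (fun i : 'I_N => posterior_moments hk hg hmodel i hF hint2 hint1 hpost).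
apply: (@filterS _ _ FP) => w moments.
have mu1 : (post (s2 w) setT = 1)%E by exact: prob_kernel.
set delta := F_bayes_estimator k F (s2 w).
have delta_gt0 i : 0 < tnth delta i.
  by have [e1 [e2 [e1_gt0 e2_gt0 _ ->]]] := moments i; exact: divr_gt0.
split=> // b b_gt0 b_neq.
pose risk (u : vec R N) i : R :=
  fine (\int[post (s2 w)]_v ((tnth v i / tnth u i - 1) ^+ 2)%:E)%E.
have mtnth i : measurable_fun setT (fun v : vec R N => tnth v i).
  exact: measurable_tnth.
have riskE i : exists e1 e2,
    [/\ 0 < e1, 0 < e2, tnth delta i = e2 / e1 &
    forall u : vec R N, positive_vec u ->
    (\int[post (s2 w)]_v ((tnth v i / tnth u i - 1) ^+ 2)%:E =
      (e2 / tnth u i ^+ 2 - 2 * (e1 / tnth u i) + 1)%:E)%E].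
  have [e1 [e2 [e1_gt0 e2_gt0 [I1 I2 I3] dE]]] := moments i.
  by exists e1, e2; split => // u u_gt0; exact: integral_square_ratio.
have lossE (u : vec R N) : positive_vec u ->
    posterior_expected_loss (@loss1 R N) post (s2 w) u = (\sum_(i < N) risk u i)%:E.
  move=> u_gt0; rewrite /posterior_expected_loss /loss1.
  under eq_integral do rewrite -sumEFin.
  rewrite ge0_integral_sum//.
  - rewrite -sumEFin; apply: eq_bigr => i _; rewrite /risk.
    by have [e1 [e2 [_ _ _ /(_ u u_gt0) ->]]] := riskE i.
  - move=> i; apply/measurable_EFinP; apply: measurable_funX.
    apply: measurable_funB => //.
    exact: (measurable_funM (mtnth i) (measurable_cst _)).
  - by move=> i v _; rewrite lee_fin sqr_ge0.
have risk_lt i : tnth b i != tnth delta i -> risk delta i < risk b i.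
  move=> bi; have [e1 [e2 [e1_gt0 e2_gt0 dE intE]]] := riskE i.
  by rewrite /risk !intE//; exact: quadratic_ratio_lt.
rewrite !lossE// lte_fin.
have [i bi] : exists i, tnth b i != tnth delta i.
  apply: contra_notP b_neq => /forallNP b_eq; apply: eq_from_tnth => i.
  by apply/eqP; apply: contra_notT (b_eq i).
rewrite (bigD1 i)//= [ltRHS](bigD1 i)//= ltr_leD ?risk_lt// ler_sum// => j _.
have [bj|/risk_lt/ltW//] := eqVneq (tnth b j) (tnth delta j).
by rewrite /risk bj.
Qed.
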